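(* Let $p\geq 17$ be a prime and let $G=SL(2,p)$ be the group of all $2\times 2$ matrices of determinant $1$ over $\mathbb{Z}_p$. Then the Cayley graph of $G$ with respect to the generating set consisting of the matrices \[x=\begin{bmatrix}1&1\\0&1\end{bmatrix}\quad\text{and}\quad y=\begin{bmatrix}1&0\\1&1\end{bmatrix}\] is a Černý Cayley graph.
   Context: For a finite set $X$, $T_X$ is the set of all maps $X\to X$, acting on the right of $X$. An automaton with state set $X$ is a subset $\Sigma\subseteq T_X$, written $(X,\Sigma)$. The free monoid $\Sigma^*$ acts on the right of $X$ via the homomorphism $\Sigma^*\to T_X$ extending the inclusion $\Sigma\hookrightarrow T_X$. A word $w\in\Sigma^*$ is synchronizing if $|Xw|=1$; the automaton is synchronizing if it admits a synchronizing word. If $G$ is a finite group with generating set $\Delta$, elements of $\Delta$ are identified with the right translations $g\mapsto gd$ of $G$, so $\Delta\subseteq T_G$; the automaton $(G,\Delta)$ is the Cayley graph of $G$ with respect to $\Delta$. $(G,\Delta)$ is a Černý Cayley graph if every synchronizing automaton $(G,\Sigma)$ with $\Delta\subseteq\Sigma\subseteq T_G$ admits a synchronizing word of length at most $(|G|-1)^2$. *)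

(* Defs.v *)
From HB Require Import structures.
From mathcomp Require Import all_boot all_order all_fingroup all_algebra.

Set Implicit Arguments.
Unset Strict Implicit.
Unset Printing Implicit Defensive.

Import GRing.Theory.

(* Automata with state set [X] are sets [Sigma : {set {ffun X -> X}}].  An     *)
(* element of the free monoid on [Sigma] is a sequence over {ffun X -> X}      *)
(* all of whose letters lie in [Sigma]; its length is [size].                  *)
Section Automata.

Variable X : finType.
Implicit Types (Sigma : {set {ffun X -> X}}) (w : seq {ffun X -> X}).

Definition is_word Sigma w := all (fun s => s \in Sigma) w.

(* Right action: the first letter of the word is applied first. *)
Definition word_act (q : X) w : X := foldl (fun r (s : {ffun X -> X}) => s r) q w.

Definition word_image w : {set X} := [set word_act q w | q : X].

Definition synchronizing_word Sigma w :=
  is_word Sigma w /\ #|word_image w| = 1%N.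

Definition synchronizing Sigma := exists w, synchronizing_word Sigma w.

End Automata.

Section CayleyGraph.

Variable gT : finGroupType.
Implicit Types Delta : {set gT}.

Definition right_translation (d : gT) : {ffun gT -> gT} :=
  [ffun g => (g * d)%g].

Definition generates Delta := <<Delta>>%g = [set: gT].

Definition cayley_graph Delta : {set {ffun gT -> gT}} :=
  [set right_translation d | d in Delta].

Definition cerny_cayley_graph Delta :=
  forall Sigma : {set {ffun gT -> gT}},
    cayley_graph Delta \subset Sigma -> synchronizing Sigma ->
    exists w, synchronizing_word Sigma w /\ (size w <= (#|gT| - 1) ^ 2)%N.

End CayleyGraph.

Section SpecialLinear.

Local Open Scope ring_scope.

Variables (n : nat) (R : finComNzRingType).

Record SL := MkSL { slval :> 'M[R]_n; sl_det : \det slval == 1 }.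

HB.instance Definition _ := [isSub for slval].
HB.instance Definition _ := [Finite of SL by <:].

Fact sl_one_subproof : \det (1%:M : 'M[R]_n) == 1.
Proof. by rewrite det1. Qed.

Fact sl_mul_subproof (A B : SL) : \det (slval A *m slval B) == 1.
Proof.
by rewrite det_mulmx (eqP (sl_det A)) (eqP (sl_det B)) mulr1.
Qed.

(* In determinant 1 the adjugate is the inverse. *)
Fact sl_inv_subproof (A : SL) : \det (\adj (slval A)) == 1.
Proof.
have := congr1 determinant (mul_mx_adj (slval A)).
by rewrite det_mulmx (eqP (sl_det A)) mul1r det1 => ->.
Qed.

Definition sl_one : SL := MkSL sl_one_subproof.
Definition sl_mul (A B : SL) : SL := MkSL (sl_mul_subproof A B).
Definition sl_inv (A : SL) : SL := MkSL (sl_inv_subproof A).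

Fact sl_mulA : associative sl_mul.
Proof. by move=> A B C; apply: val_inj; rewrite /= mulmxA. Qed.

Fact sl_mul1 : left_id sl_one sl_mul.
Proof. by move=> A; apply: val_inj; rewrite /= mul1mx. Qed.

Fact sl_mulV : left_inverse sl_one sl_inv sl_mul.
Proof.
by move=> A; apply: val_inj; rewrite /= mul_adj_mx (eqP (sl_det A)).
Qed.

HB.instance Definition _ := Finite_isGroup.Build SL sl_mulA sl_mul1 sl_mulV.

End SpecialLinear.

Section Transvections.

Local Open Scope ring_scope.

Variable R : finComNzRingType.

Definition mx22 (a b c d : R) : 'M[R]_2 :=
  \matrix_(i, j) nth 0 (nth [::] [:: [:: a; b]; [:: c; d]] i) j.

Fact det_mx22 (a b c d : R) : \det (mx22 a b c d) = a * d - b * c.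
Proof.
rewrite (expand_det_row _ ord0) !big_ord_recl big_ord0 addr0 /cofactor.
by rewrite !det_mx11 !mxE /= expr0 expr1 mul1r mulN1r mulrN.
Qed.

Fact sl_x_subproof : \det (mx22 1 1 0 1) == 1.
Proof. by rewrite det_mx22 mulr1 mulr0 subr0. Qed.

Fact sl_y_subproof : \det (mx22 1 0 1 1) == 1.
Proof. by rewrite det_mx22 mulr1 mul0r subr0. Qed.

Definition sl_x : SL 2 R := MkSL sl_x_subproof.
Definition sl_y : SL 2 R := MkSL sl_y_subproof.

End Transvections.

(* Main.v *)
Require Import Defs.
From mathcomp Require Import all_boot all_order all_fingroup all_algebra.
From mathcomp Require Import all_solvable all_field zify ring.

Set Implicit Arguments.
Unset Strict Implicit.
Unset Printing Implicit Defensive.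

Import Order.TTheory GRing.Theory Num.Theory.
Local Open Scope ring_scope.

(** Let [G = SL(2, p)] have [n] elements. A synchronizing word is built backwards:
    some letter has a fibre with at least two points, and it suffices to show that
    every proper non-empty subset [S] of [G] is the target of a word of length at
    most [n] with a larger preimage, as then [1 + (n - 2) * n = (n - 1) ^ 2]
    letters are enough ([short_synchronizing_word]).

    The deviation of a word from being a permutation is recorded by a row of zero
    sum in the regular representation over the rationals, its [excess], whose
    pairing with the indicator of [S] is the change of cardinality. The sum over
    all translations of an excess vanishes. Hence it is enough that the excess of
    some word of length at most [n - d] has a translate pairing non-trivially with
    [S], where [d] bounds the length of group elements as words in [x] and [y]:
    then some translate pairs positively ([positive_translate]). Extending spans of
    excesses letter by letter costs one letter per dimension, which in the space of
    rows of zero sum is too much by about [d] letters. But once a span is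
    translated by all of [G], it becomes a submodule within [d] steps, and if the
    submodule has grown by a representation of dimension greater than [d], letters
    are saved. This is [excess_chain]; it saves [d] letters if a large part [R] of
    the regular representation is made of large irreducible representations
    ([cerny_criterion]).

    For [R] one takes the vectors fixed by the lower unipotent subgroup on which
    the diagonal torus, cyclic of order [p - 1], acts by faithful characters. There
    are [totient (p - 1)] such characters and they are conjugate over the
    rationals, so a submodule meeting [R] meets it in dimension [r] at least
    [totient (p - 1)] ([primitive_space_dim]), which is at least [6] for [p >= 17];
    its own dimension is then at least [(p + 1) * r / 2] ([principal_dim]), the sum
    over the conjugates of the unipotent subgroup being a central element whose
    trace can be computed in two ways. The cosets of the Borel subgroup show that
    [R] has dimension at least [p * totient (p - 1)] ([principal_large]). On the
    other hand every element of [G] is a word of length at most [3 * p - 2] in [x]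
    and [y] ([short_word]), by writing it as a product of a lower, an upper and a
    lower unipotent matrix. *)

(** * Orthogonal complements over the rationals *)

(** Permutation matrices are orthogonal, so an invariant subspace has an invariant
    complement, namely its orthogonal one; positivity of sums of squares makes
    this work over the rationals without averaging. *)
Section OrthogonalComplement.
Variable n : nat.
Implicit Types (N A : 'M[rat]_n).

Definition orth N := kermx N^T.

Lemma sub_orthP m (v : 'M[rat]_(m, n)) N : reflect (v *m N^T = 0) (v <= orth N)%MS.
Proof. exact: sub_kermxP. Qed.

(** A row of the intersection has scalar square zero. *)
Lemma orth_cap0 N : (N :&: orth N)%MS = 0.
Proof.
apply/eqP/rowV0P => u; rewrite sub_capmx => /andP[/submxP[x ux]] /sub_orthP uN.
have: u *m u^T = 0 by rewrite {2}ux trmx_mul mulmxA uN mul0mx.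
move/matrixP/(_ 0 0); rewrite !mxE => /eqP.
rewrite psumr_eq0 => [/allP s0|i _]; last by rewrite !mxE -expr2 sqr_ge0.
apply/rowP=> j; have := s0 j (mem_index_enum _).
by rewrite !mxE -expr2 sqrf_eq0 => /eqP.
Qed.

Lemma orth_add1 N : (N + orth N :=: 1%:M)%MS.
Proof.
apply/eqmxP; rewrite submx1 sub1mx -col_leq_rank /=.
have := mxrank_sum_cap N (orth N).
rewrite orth_cap0 mxrank0 addn0 => ->.
by rewrite /orth mxrank_ker mxrank_tr subnKC // rank_leq_col.
Qed.

Definition oproj N := proj_mx N (orth N).

Lemma oproj_sub m (v : 'M[rat]_(m, n)) N : (v *m oproj N <= N)%MS.
Proof. exact: proj_mx_sub. Qed.

Lemma oproj_id m (v : 'M[rat]_(m, n)) N : (v <= N)%MS -> v *m oproj N = v.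
Proof. by move=> vN; rewrite proj_mx_id ?orth_cap0. Qed.

Lemma oproj0 m (v : 'M[rat]_(m, n)) N : (v <= orth N)%MS -> v *m oproj N = 0.
Proof. by move=> vN; rewrite proj_mx_0 ?orth_cap0. Qed.

Lemma sub_oproj_orth m (v : 'M[rat]_(m, n)) N : ((v - v *m oproj N)%R <= orth N)%MS.
Proof. by apply: proj_mx_compl_sub; rewrite orth_add1 submx1. Qed.

(** The two hypotheses make [N] and [orth N] invariant under [A]. *)
Lemma oproj_comm N A : stablemx N A -> stablemx N A^T ->
  oproj N *m A = A *m oproj N.
Proof.
move=> sA sAT.
have oA : (orth N *m A <= orth N)%MS.
  apply/sub_orthP; rewrite -mulmxA -[A]trmxK -trmx_mul.
  have /submxP[B ->] := sAT.
  by rewrite trmx_mul mulmxA mulmx_ker mul0mx.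
rewrite -[A *m _]mul1mx -[X in X *m (A *m _)](subrK (oproj N)) mulmxDl mulmxA.
rewrite (mulmxA (oproj N)) oproj0 ?add0r; last first.
  apply: submx_trans (submxMr A _) oA.
  by rewrite -[oproj N]mul1mx sub_oproj_orth.
rewrite oproj_id // (submx_trans _ sA) // submxMr //.
by rewrite -[oproj N]mul1mx oproj_sub.
Qed.

Lemma rank_orth_cap N N' : (N <= N')%MS ->
  \rank N' = (\rank N + \rank (N' :&: orth N))%N.
Proof.
move=> NN'.
have -> : \rank N' = \rank (N + (N' :&: orth N))%MS.
  apply: eqmx_rank; apply/andP; split; last by rewrite addsmx_sub NN' capmxSl.
  have N'p : (N' *m oproj N <= N)%MS := oproj_sub _ _.
  have: ((N' *m oproj N + (N' - N' *m oproj N))%R <= N + (N' :&: orth N))%MS.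
    rewrite addmx_sub_adds // sub_capmx sub_oproj_orth andbT.
    by rewrite addmx_sub ?submx_refl // eqmx_opp (submx_trans N'p).
  by rewrite addrC subrK.
have := mxrank_sum_cap N (N' :&: orth N)%MS.
by rewrite capmxA (capmxC N) -capmxA orth_cap0 capmx0 mxrank0 addn0 => <-.
Qed.

(** Factoring [E] as [C *m B] through its row space, idempotency forces
    [B *m C = 1], whose trace is the rank. *)
Lemma mxtrace_idem (K : numFieldType) m (E : 'M[K]_m) : E *m E = E -> \tr E = (\rank E)%:R.
Proof.
move=> EE.
have [C [B [CB fC fB]]] : exists C (B : 'M_(\rank E, m)),
    [/\ C *m B = E, row_full C & row_free B].
  exists (col_base E), (row_base E).
  by rewrite mulmx_base col_base_full row_base_free.
have BC1 : B *m C = 1%:M.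
  apply: (row_free_inj fB); rewrite mul1mx.
  have /(congr1 (mulmx (pinvmx C))) : C *m (B *m C *m B) = C *m B.
    by rewrite !mulmxA CB -mulmxA CB EE.
  by rewrite !mulmxA mulVpmx // !mul1mx.
by rewrite -CB mxtrace_mulC BC1 mxtrace1 CB.
Qed.

End OrthogonalComplement.

(** * Transformations as matrices and the regular representation *)

Section TransformationMatrices.
Variable X : finType.
Local Notation n := #|X|.
Implicit Types (f g : X -> X) (S : {set X}).

Definition fmx f : 'M[rat]_n :=
  \matrix_(i, j) (f (enum_val i) == enum_val j)%:R.
Definition basis_row (x : X) : 'rV[rat]_n := delta_mx 0 (enum_rank x).
Definition indicator S : 'cV[rat]_n := \col_j (enum_val j \in S)%:R.

Lemma basis_rowE x j : basis_row x 0 j = (x == enum_val j)%:R.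
Proof. by rewrite mxE eqxx -(inj_eq enum_val_inj) enum_rankK eq_sym. Qed.

Lemma row_fmx f i : row i (fmx f) = basis_row (f (enum_val i)).
Proof. by apply/rowP=> j; rewrite basis_rowE !mxE. Qed.

Lemma basis_row_fmx f x : basis_row x *m fmx f = basis_row (f x).
Proof. by rewrite /basis_row -rowE row_fmx enum_rankK. Qed.

Lemma fmxM f g : fmx f *m fmx g = fmx (g \o f).
Proof.
by apply/row_matrixP=> i; rewrite row_mul !row_fmx basis_row_fmx.
Qed.

Lemma fmx_id : fmx id = 1%:M.
Proof.
apply/row_matrixP=> i; rewrite row_fmx row1 /basis_row enum_valK.
by [].
Qed.

Lemma eq_fmx f g : f =1 g -> fmx f = fmx g.
Proof. by move=> fg; apply/matrixP=> i j; rewrite !mxE fg. Qed.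

Definition sum_row : 'rV[rat]_n := const_mx 1.

Lemma sum_rowE : sum_row = \sum_x basis_row x.
Proof.
apply/rowP=> j; rewrite summxE (bigD1 (enum_val j)) //= basis_rowE !mxE eqxx.
by rewrite big1 ?addr0 // => x; rewrite basis_rowE => /negPf->.
Qed.

Lemma basis_row_indicator x S : basis_row x *m indicator S = (x \in S)%:R%:M.
Proof.
apply/matrixP=> i j; rewrite !ord1 /basis_row -rowE !mxE eqxx.
by rewrite enum_rankK.
Qed.

(** For a map [f] the entry of [sum_row *m fmx f] at [y] is the number of
    preimages of [y]; the excess of [f] is that row minus the constant [1], so
    that pairing it with the indicator of [S] measures how much larger the
    preimage of [S] is than [S] itself. *)
Definition excess f : 'rV[rat]_n := sum_row *m fmx f - sum_row.

Lemma sum_row_fmx f S :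
  sum_row *m fmx f *m indicator S = #|f @^-1: S|%:R%:M.
Proof.
rewrite sum_rowE !mulmx_suml.
under eq_bigr do rewrite basis_row_fmx basis_row_indicator.
apply/matrixP=> i j; rewrite !ord1 summxE !mxE eqxx -sum1_card natr_sum.
rewrite [RHS]big_mkcond; apply: eq_bigr => x _; rewrite !mxE inE.
by case: (f x \in S).
Qed.

Lemma excess_indicator f S :
  excess f *m indicator S = (#|f @^-1: S|%:R - #|S|%:R)%:M.
Proof.
rewrite mulmxBl sum_row_fmx -[sum_row]mulmx1 -fmx_id sum_row_fmx.
rewrite -raddfB /=; congr (_ - _%:R)%:M.
by apply: eq_card => x; rewrite inE.
Qed.

Lemma excess_comp f g : excess (g \o f) = excess f *m fmx g + excess g.
Proof. by rewrite /excess mulmxBl -mulmxA fmxM addrA subrK. Qed.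

Lemma excess_id : excess id = 0.
Proof. by rewrite /excess fmx_id mulmx1 subrr. Qed.

(** The rows of zero sum, which contain all excesses. *)
Definition augmentation : 'M[rat]_n := kermx (const_mx 1 : 'cV[rat]_n).

Lemma fmx_ones f : fmx f *m const_mx 1 = const_mx 1 :> 'cV[rat]_n.
Proof.
apply/row_matrixP=> i; rewrite row_mul row_fmx /basis_row -rowE.
by apply/rowP=> j; rewrite !mxE.
Qed.

Lemma excess_aug f : (excess f <= augmentation)%MS.
Proof.
by apply/sub_kermxP; rewrite mulmxBl -mulmxA fmx_ones subrr.
Qed.

Lemma augmentation_stable f : stablemx augmentation (fmx f).
Proof. by apply/sub_kermxP; rewrite -mulmxA fmx_ones mulmx_ker. Qed.

Lemma rank_augmentation : (0 < n)%N -> \rank augmentation = n.-1.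
Proof.
move=> n0; rewrite mxrank_ker -subn1; congr (n - _)%N.
apply/eqP; rewrite eqn_leq rank_leq_col lt0n mxrank_eq0.
apply/eqP=> /matrixP/(_ (Ordinal n0) 0)/eqP.
by rewrite !mxE oner_eq0.
Qed.

End TransformationMatrices.

Section RegularRepresentation.
Variable gT : finGroupType.
Local Notation n := #|gT|.
Implicit Types (g h : gT) (S : {set gT}) (N R : 'M[rat]_n).

Definition rho g : 'M[rat]_n := fmx (fun h => (h * g)%g).

Lemma rhoM g h : rho (g * h) = rho g *m rho h.
Proof. by rewrite /rho fmxM; apply: eq_fmx => k /=; rewrite mulgA. Qed.

Lemma rho1 : rho 1 = 1%:M.
Proof. by rewrite -fmx_id; apply: eq_fmx => k /=; rewrite mulg1. Qed.

Lemma rho_tr g : (rho g)^T = rho g^-1.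
Proof.
apply/matrixP=> i j; rewrite !mxE; congr ((_ : bool)%:R).
by apply/eqP/eqP => <-; rewrite ?mulgK ?mulgKV.
Qed.

Lemma basis_row_rho g h : basis_row h *m rho g = basis_row (h * g)%g.
Proof. exact: basis_row_fmx. Qed.

(** Translations are permutations, hence have no excess; with [excess_comp] this
    makes appending a translation act linearly on excesses. *)
Lemma excess_rho g : excess (fun h => h * g)%g = 0.
Proof.
apply/eqP; rewrite subr_eq0 sum_rowE mulmx_suml.
under eq_bigr do rewrite basis_row_fmx.
by rewrite [X in _ == X](reindex_inj (mulIg g)).
Qed.

Lemma sum_rho_aug m (v : 'M[rat]_(m, n)) :
  (v <= augmentation gT)%MS -> v *m (\sum_g rho g) = 0.
Proof.
move=> /sub_kermxP v0.
have -> : \sum_g rho g = const_mx 1 *m sum_row gT :> 'M[rat]_n.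
  apply/row_matrixP=> i; rewrite linear_sum row_mul /= sum_rowE.
  under eq_bigr do rewrite row_fmx.
  have -> : row i (const_mx 1 : 'cV[rat]_n) = 1%:M.
    by apply/rowP=> j; rewrite !mxE ord1.
  by rewrite mul1mx [RHS](reindex_inj (mulgI (enum_val i))).
by rewrite mulmxA v0 mul0mx.
Qed.

(** The translates of a row of zero sum pair with [S] to values of sum zero,
    so as soon as one of them is non-zero another one is positive. *)
Lemma positive_translate f S g :
    excess f *m rho g *m indicator S != 0 ->
  exists h, (#|S| < #|(fun x => f x * h)%g @^-1: S|)%N.
Proof.
move=> nz.
have E h : excess f *m rho h *m indicator S =
    (#|(fun x => f x * h)%g @^-1: S|%:R - #|S|%:R)%:M.
  rewrite -excess_indicator; congr (_ *m _).
  by rewrite -[LHS]addr0 -(excess_rho h) -excess_comp.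
have: \sum_h excess f *m rho h *m indicator S = 0.
  by rewrite -mulmx_suml -mulmx_sumr sum_rho_aug ?mul0mx // excess_aug.
move=> /matrixP/(_ 0 0); rewrite summxE mxE => s0.
apply/existsP; apply: contraNT nz; rewrite negb_exists => /forallP le.
have le0 h : - ((excess f *m rho h *m indicator S) 0 0) >= 0.
  by rewrite E !mxE eqxx mulr1n opprB subr_ge0 ler_nat leqNgt.
move/eqP: s0; rewrite -oppr_eq0 -sumrN psumr_eq0 // => /allP/(_ g).
rewrite mem_index_enum oppr_eq0 => /(_ isT) /eqP z.
by apply/eqP/matrixP=> i j; rewrite !ord1 z mxE.
Qed.

Definition submodule N := forall g, stablemx N (rho g).

Lemma submodule_cap N1 N2 : submodule N1 -> submodule N2 -> submodule (N1 :&: N2)%MS.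
Proof.
move=> s1 s2 g; rewrite sub_capmx.
apply/andP; split; [apply: submx_trans (s1 g)|apply: submx_trans (s2 g)].
  by rewrite submxMr ?capmxSl.
by rewrite submxMr ?capmxSr.
Qed.

Lemma submodule_orth N : submodule N -> submodule (orth N).
Proof.
move=> s g; apply/sub_orthP; rewrite -mulmxA -[rho g]trmxK -trmx_mul rho_tr.
have /submxP[B ->] := s g^-1%g.
by rewrite trmx_mul mulmxA mulmx_ker mul0mx.
Qed.

Lemma oproj_rho N g : submodule N -> oproj N *m rho g = rho g *m oproj N.
Proof. by move=> s; apply: oproj_comm; rewrite ?rho_tr. Qed.

(** The commutant of the right translations consists of the linear combinations
    of left translations. A left stable [R] is invariant under the orthogonal
    projection onto any submodule, so that intersecting with [R] is additive along
    orthogonal decompositions, as it is for an isotypic component. *)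
Definition left_stable R :=
  forall A : 'M[rat]_n, (forall g, A *m rho g = rho g *m A) -> stablemx R A.

(** An element of [N' :&: R] is the sum of its two orthogonal projections, and both
    of them lie in [R] because it is left stable. *)
Lemma rank_cap_orth N N' R : submodule N -> (N <= N')%MS -> left_stable R ->
  (\rank (N' :&: R) <= \rank (N :&: R) + \rank (N' :&: orth N :&: R))%N.
Proof.
move=> sN NN' sR.
have [le _] := mxrank_adds_leqif (N :&: R)%MS (N' :&: orth N :&: R)%MS.
apply: leq_trans le; apply: mxrankS.
set C := (N' :&: R)%MS.
have CN' : (C <= N')%MS := capmxSl _ _.
have CR : (C <= R)%MS := capmxSr _ _.
have CpN : (C *m oproj N <= N)%MS := oproj_sub _ _.
have CpR : (C *m oproj N <= R)%MS.
  by apply: submx_trans (submxMr _ CR) (sR _ _) => g; apply: oproj_rho.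
have: ((C *m oproj N + (C - C *m oproj N))%R <= (N :&: R) + (N' :&: orth N :&: R))%MS.
  rewrite addmx_sub_adds ?sub_capmx ?CpN ?CpR //= sub_oproj_orth andbT.
  by apply/andP; split; apply: addmx_sub; rewrite ?eqmx_opp // (submx_trans CpN).
by rewrite addrC subrK.
Qed.

End RegularRepresentation.

(** * A criterion for Cerny Cayley graphs *)

Section Words.
Variable X : finType.
Local Notation n := #|X|.
Variable Sigma : {set {ffun X -> X}}.
Implicit Types (f : {ffun X -> X}) (N L : 'M[rat]_n).

Definition append f (a : {ffun X -> X}) : {ffun X -> X} := [ffun x => a (f x)].

(** The transformations induced by the words of length at most [l]. *)
Fixpoint reach l : {set {ffun X -> X}} :=
  if l is k.+1 then
    reach k :|: [set append f a | f in reach k, a in Sigma]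
  else [set [ffun x => x]].

Lemma reachP l f : f \in reach l ->
  exists w, [/\ is_word Sigma w, (size w <= l)%N & f =1 (fun x => word_act x w)].
Proof.
elim: l f => [|l IH] f /=.
  by rewrite inE => /eqP->; exists [::]; split=> // x; rewrite ffunE.
rewrite inE => /orP[/IH[w [ww sw fw]]|/imset2P[f' a /IH[w [ww sw fw]] aS ->]].
  by exists w; split=> //; apply: leq_trans sw _.
exists (rcons w a); split; first by rewrite /is_word all_rcons aS.
  by rewrite size_rcons.
by move=> x; rewrite ffunE fw /word_act foldl_rcons.
Qed.

Lemma id_reach l : [ffun x => x] \in reach l.
Proof. by elim: l => [|l IH] /=; rewrite !inE ?eqxx ?IH. Qed.

Definition excess_span l : 'M[rat]_n :=
  (\sum_(f in reach l) <<excess f>>)%MS.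

Lemma excess_span_sup l f : f \in reach l -> (excess f <= excess_span l)%MS.
Proof. by move=> fl; apply: sumsmx_sup fl _; rewrite genmxE. Qed.

Lemma excess_spanS l : (excess_span l <= excess_span l.+1)%MS.
Proof.
apply/sumsmx_subP => f fl; rewrite genmxE; apply: excess_span_sup => /=.
by rewrite inE fl.
Qed.

Lemma excess_span_aug l : (excess_span l <= augmentation X)%MS.
Proof. by apply/sumsmx_subP => f _; rewrite genmxE excess_aug. Qed.

Lemma excess_letter l (a : {ffun X -> X}) : a \in Sigma -> (excess a <= excess_span l.+1)%MS.
Proof.
move=> aS; have -> : excess a = excess (append [ffun x => x] a).
  by rewrite /excess; congr (_ *m _ - _); apply: eq_fmx => x; rewrite !ffunE.
apply: excess_span_sup; rewrite inE; apply/orP; right; apply: imset2_f => //.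
exact: id_reach.
Qed.

(** One more letter [a] turns the excess of [f] into the image of that excess
    under [a] plus the excess of [a]. *)
Lemma excess_span_letter l m (L : 'M_(m, n)) a : a \in Sigma ->
  (L <= excess_span l)%MS -> (L *m fmx a <= excess_span l.+1)%MS.
Proof.
move=> aS LT; apply: submx_trans (submxMr _ LT) _.
have [_ ->] := sumsmxMr (fun f => f \in reach l) (fun f => <<excess f>>%MS) (fmx a).
apply/sumsmx_subP => f fl; have [_ ->] := eqmxMr (fmx a) (genmxE (excess f)).
have -> : excess f *m fmx a = excess (append f a) - excess a.
  rewrite -[LHS](addrK (excess a)) -excess_comp; congr (_ - _).
  by rewrite /excess; congr (_ *m _ - _); apply: eq_fmx => x; rewrite !ffunE.
apply: addmx_sub; last by rewrite eqmx_opp excess_letter.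
apply: excess_span_sup; rewrite inE; apply/orP; right.
exact: imset2_f.
Qed.

(** The letters of the word are appended one at a time, by [excess_comp]. *)
Lemma excess_word N w : is_word Sigma w ->
    (forall a : {ffun X -> X}, a \in Sigma -> (excess a <= N)%MS) ->
    (forall a : {ffun X -> X}, a \in Sigma -> stablemx N (fmx a)) ->
  (excess (fun x => word_act x w) <= N)%MS.
Proof.
move=> ww eN sN; elim/last_ind: w ww => [|w a IH].
  by move=> _; rewrite [excess _]excess_id sub0mx.
rewrite /is_word all_rcons => /andP[aS ww].
have -> : excess (fun x => word_act x (rcons w a)) = excess (a \o fun x => word_act x w).
  rewrite /excess; congr (_ *m _ - _).
  by apply: eq_fmx => x /=; rewrite /word_act foldl_rcons.
rewrite excess_comp addmx_sub ?eN //.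
by apply: submx_trans (submxMr _ (IH ww)) (sN _ aS).
Qed.

End Words.

Section Criterion.
Variable gT : finGroupType.
Local Notation n := #|gT|.
Variables (Delta : {set gT}) (d : nat).
Hypothesis diameter : forall g, exists s : seq gT,
  [/\ all (fun h => h \in Delta) s, (size s <= d)%N & g = (\prod_(h <- s) h)%g].
Implicit Types (S : {set gT}) (N L R : 'M[rat]_n).

Definition grow L : 'M[rat]_n := (L + \sum_(h in Delta) <<L *m rho h>>)%MS.

Lemma sub_grow L : (L <= grow L)%MS.
Proof. exact: addsmxSl. Qed.

Lemma grow_rho L h : h \in Delta -> (L *m rho h <= grow L)%MS.
Proof.
move=> hD; apply: submx_trans _ (addsmxSr _ _).
by apply: sumsmx_sup hD _; rewrite genmxE.
Qed.

Lemma grow_sub L N : (L <= N)%MS ->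
  (forall h, h \in Delta -> (L *m rho h <= N)%MS) -> (grow L <= N)%MS.
Proof.
move=> LN sLN; rewrite addsmx_sub LN; apply/sumsmx_subP => h hD.
by rewrite genmxE sLN.
Qed.

Lemma iter_grow_prod L k s : all (fun h => h \in Delta) s -> (size s <= k)%N ->
  (L *m rho (\prod_(h <- s) h)%g <= iter k grow L)%MS.
Proof.
elim/last_ind: s k => [|s h IH] k.
  move=> _ _; rewrite big_nil rho1 mulmx1; elim: k => //= k IHk.
  exact: submx_trans IHk (sub_grow _).
rewrite all_rcons size_rcons => /andP[hD sD]; case: k => // k sk.
rewrite -cats1 big_cat big_seq1 rhoM mulmxA.
apply: submx_trans (submxMr _ (IH k sD sk)) _; exact: grow_rho.
Qed.

Lemma submodule_gen N :
  (forall h, h \in Delta -> stablemx N (rho h)) -> submodule N.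
Proof.
move=> sN g; have [s [sD _ ->]] := diameter g; elim: s sD => [|h s IH] /=.
  by rewrite big_nil rho1 mulmx1.
move=> /andP[hD sD]; rewrite big_cons rhoM.
by apply: stablemxM; [apply: sN | apply: IH].
Qed.

(** All group elements are reached in [d] steps, so the growth stops by then; and
    as long as it has not stopped, every step gains a dimension. *)
Lemma grow_submodule L : exists k, [/\ (k <= d)%N, submodule (iter k grow L)
  & (\rank L + k <= \rank (iter k grow L))%N].
Proof.
pose stop k := (grow (iter k grow L) <= iter k grow L)%MS.
have stopd : stop d.
  pose C := (\sum_g <<L *m rho g>>)%MS : 'M[rat]_n.
  have CL : (C <= iter d grow L)%MS.
    apply/sumsmx_subP => g _; rewrite genmxE.
    by have [s [sD sd ->]] := diameter g; apply: iter_grow_prod.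
  have LC k : (iter k grow L <= C)%MS.
    elim: k => [|k IH] /=.
      by apply: (sumsmx_sup 1%g) => //; rewrite genmxE rho1 mulmx1.
    apply: (grow_sub IH) => h _; apply: (submx_trans (submxMr _ IH)).
    have [_ ->] := sumsmxMr xpredT (fun g => <<L *m rho g>>%MS) (rho h).
    apply/sumsmx_subP => g _.
    have [_ ->] := eqmxMr (rho h) (genmxE (L *m rho g)).
    by rewrite -mulmxA -rhoM; apply: (sumsmx_sup (g * h)%g); rewrite ?genmxE.
  exact: submx_trans (LC d.+1) CL.
have ex : exists k, stop k by exists d.
case: (ex_minnP ex) => k stopk mink; exists k; split; first exact: mink.
  apply: submodule_gen => h hD; apply: submx_trans stopk; exact: grow_rho.
have lt j : (j < k)%N -> (\rank (iter j grow L) < \rank (iter j.+1 grow L))%N.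
  move=> jk; rewrite ltn_neqAle mxrankS ?sub_grow // andbT.
  apply/negP => /eqP eq; have : stop j.
    by rewrite /stop -(mxrank_leqif_sup (sub_grow _)) /= eq.
  by move/mink; rewrite leqNgt jk.
have: (k <= k)%N by []; elim: {1 3 4}k => [|j IH] jk /=; first by rewrite addn0.
by rewrite addnS; apply: leq_ltn_trans (IH (ltnW jk)) (lt j jk).
Qed.

Variables (Sigma : {set {ffun gT -> gT}}) (R : 'M[rat]_n).
Hypothesis cayley_sub : cayley_graph Delta \subset Sigma.
Hypothesis R_stable : left_stable R.
Hypothesis R_aug : (R <= augmentation gT)%MS.
Hypothesis R_large : (2 * d <= \rank R)%N.
(* When a submodule grows by [M], at a cost of one letter and at most [d]
   translations, this cost stays below the dimension of [M] by half the dimension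
   of its intersection with [R]. *)
Hypothesis R_gain : forall M, submodule M ->
  \rank (M :&: R)%MS = 0%N \/ (2 * d.+1 + \rank (M :&: R) <= 2 * \rank M)%N.

Lemma translation_letter h : h \in Delta -> right_translation h \in Sigma.
Proof. by move=> hD; apply: (subsetP cayley_sub); apply: imset_f. Qed.

Lemma fmx_translation (h : gT) : fmx (right_translation h) = rho h.
Proof. by apply: eq_fmx => x; rewrite ffunE. Qed.

Lemma iter_grow_span l L k : (L <= excess_span Sigma l)%MS ->
  (iter k grow L <= excess_span Sigma (l + k))%MS.
Proof.
move=> Ll; elim: k => [|k IH]; rewrite ?addn0 ?addnS //=.
apply: grow_sub; first exact: submx_trans IH (excess_spanS _ _).
move=> h hD; rewrite -fmx_translation.
by apply: excess_span_letter IH; apply: translation_letter.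
Qed.

(** In the next two lemmas [rN] and [fN] stand for the dimensions of a submodule
    [N] and of its intersection with [R], and likewise for [N'] and for the
    orthogonal complement [M] of [N] in a larger submodule. *)
Lemma budget_arith l r rN rM fN fM m :
  (0 < m)%N -> fM = 0%N \/ (2 * d.+1 + fM <= 2 * rM)%N -> m.-1 = (rN + rM)%N ->
  (r <= fN + fM)%N -> (2 * d <= r)%N -> (2 * l + fN <= 2 * rN)%N -> (l + d < m)%N.
Proof. lia. Qed.

Lemma step_arith l k rL rN rM rN' fN fM fN' :
  (rN < rL)%N -> (rL + k <= rN')%N -> (k <= d)%N ->
  fM = 0%N \/ (2 * d.+1 + fM <= 2 * rM)%N -> rN' = (rN + rM)%N ->
  (fN' <= fN + fM)%N -> (2 * l + fN <= 2 * rN)%N ->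
  (2 * (l.+1 + k) + fN' <= 2 * rN')%N.
Proof. lia. Qed.

(** The dimension of the complement of [N] in the augmentation module is at least
    half that of its intersection with [R]. So [l] is below the dimension of the
    whole augmentation module by half the rank of [R], that is by at least [d]. *)
Lemma submodule_budget l N : submodule N -> (N <= augmentation gT)%MS ->
  (2 * l + \rank (N :&: R) <= 2 * \rank N)%N -> (l + d < n)%N.
Proof.
move=> sN Na le.
have sM := submodule_cap (fun g => augmentation_stable _) (submodule_orth sN).
have := rank_cap_orth sN Na R_stable; have := rank_orth_cap Na.
have -> : \rank (augmentation gT :&: R) = \rank R.
  by apply: eqmx_rank; apply/andP; split; rewrite ?capmxSr // sub_capmx R_aug /=.
have n0 : (0 < n)%N by apply/card_gt0P; exists 1%g.
rewrite rank_augmentation // => eqr lef.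
exact: budget_arith n0 (R_gain sM) eqr lef R_large le.
Qed.

(** A submodule [N] of the span of the excesses of the words of length at most [l]
    is enlarged step by step, keeping [l] below the dimension of [N] by at least
    half the dimension of [N :&: R]. If [N] contains the excesses of all words,
    then one of those short words already pairs non-trivially with [v]. Otherwise
    some letter leads out of [N], and at most [d] further letters close up the
    result to a larger submodule. Either the part gained avoids [R], and each
    letter has gained a dimension; or it meets [R], and [R_gain] applies. *)
Lemma excess_chain (v : 'cV[rat]_n) (f0 : gT -> gT) w0 g0 :
    f0 =1 (fun x => word_act x w0) -> is_word Sigma w0 -> excess f0 *m rho g0 *m v != 0 ->
  exists l f, [/\ f \in reach Sigma l, (l + d < n)%N & excess f *m rho g0 *m v != 0].
Proof.
move=> f0w0 ww0 nz.
pose good l N := [/\ submodule N, (N <= excess_span Sigma l)%MS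
  & (2 * l + \rank (N :&: R) <= 2 * \rank N)%N].
suff chain l N : good l N ->
    exists l f, [/\ f \in reach Sigma l, (l + d < n)%N & excess f *m rho g0 *m v != 0].
  apply: (chain 0%N 0).
  split=> [g||]; rewrite ?mul0mx ?sub0mx //.
  by rewrite cap0mx mxrank0.
have [m] := ubnP (n - \rank N); elim: m => // m IH in l N * => lem [sN NT le].
have Na : (N <= augmentation gT)%MS := submx_trans NT (excess_span_aug _ _).
have bud := submodule_budget sN Na le.
have step L : (N <= L)%MS -> ~~ (L <= N)%MS -> (L <= excess_span Sigma l.+1)%MS ->
    exists l f, [/\ f \in reach Sigma l, (l + d < n)%N & excess f *m rho g0 *m v != 0].
  move=> NL LN LT.
  have rNL : (\rank N < \rank L)%N.
    by rewrite ltn_neqAle mxrankS // andbT (mxrank_leqif_sup NL).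
  have [k [kd sN' rk]] := grow_submodule L.
  set N' := iter k grow L in sN' rk.
  have NN' : (N <= N')%MS.
    apply: submx_trans NL _; rewrite /N'; elim: (k) => //= j IHj.
    exact: submx_trans IHj (sub_grow _).
  apply: (IH (l.+1 + k)%N N'); first by have := rank_leq_row N'; lia.
  split=> //; first exact: iter_grow_span.
  have sM := submodule_cap sN' (submodule_orth sN).
  exact: step_arith rNL rk kd (R_gain sM) (rank_orth_cap NN')
    (rank_cap_orth sN NN' R_stable) le.
have [/forall_inP ex|] := boolP [forall a in Sigma, (excess (a : {ffun gT -> gT}) <= N)%MS]; last first.
  rewrite negb_forall_in => /exists_inP[a aS aN].
  apply: (step (N + <<excess a>>)%MS); rewrite ?addsmxSl //.
    by rewrite addsmx_sub submx_refl genmxE.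
  by rewrite addsmx_sub genmxE excess_letter // (submx_trans NT (excess_spanS _ _)).
have [/forall_inP st|] := boolP [forall a in Sigma, stablemx N (fmx (a : {ffun gT -> gT}))]; last first.
  rewrite negb_forall_in => /exists_inP[a aS aN].
  apply: (step (N + N *m fmx a)%MS); rewrite ?addsmxSl //.
    by rewrite addsmx_sub submx_refl.
  by rewrite addsmx_sub excess_span_letter // (submx_trans NT (excess_spanS _ _)).
have f0N : (excess f0 <= N)%MS.
  rewrite /excess (eq_fmx f0w0); exact: (excess_word ww0 ex st).
have [/exists_inP[f fl fnz]|] := boolP [exists f in reach Sigma l, excess (f : {ffun gT -> gT}) *m rho g0 *m v != 0].
  by exists l, f; split=> //; have := bud; lia.
rewrite negb_exists_in => /forall_inP z.
case/negP: nz; rewrite -mulmxA; apply/eqP.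
have T0 : (excess_span Sigma l <= kermx (rho g0 *m v))%MS.
  apply/sumsmx_subP => f fl; rewrite genmxE; apply/sub_kermxP.
  by rewrite mulmxA; apply/eqP; have := z f fl; rewrite negbK.
exact/sub_kermxP/(submx_trans (submx_trans f0N NT) T0).
Qed.

Lemma word_act_translations (s : seq gT) x :
  word_act x (map (fun h => right_translation h) s) = (x * \prod_(h <- s) h)%g.
Proof.
elim: s x => [|h s IH] x; first by rewrite big_nil mulg1.
by rewrite /= -/(word_act _ _) IH ffunE big_cons mulgA.
Qed.

(** A synchronizing word followed by a suitable translation pulls [S] back to the
    whole group, so some excess pairs non-trivially with [S]; by [excess_chain] the
    excess of a short word does, and at most [d] further letters make the pairing
    positive. *)
Lemma preimage_extension S : synchronizing Sigma -> S != set0 -> S != setT ->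
  exists w, [/\ is_word Sigma w, (size w <= n)%N
    & (#|S| < #|[set x | word_act x w \in S]|)%N].
Proof.
move=> [w0 [ww0 /eqP/cards1P[q im0]]] /set0Pn[s sS] SnT.
have act0 x : word_act x w0 = q.
  by apply/set1P; rewrite -im0; apply: imset_f.
pose f0 x := word_act x w0.
have nz : excess f0 *m rho (q^-1 * s)%g *m indicator S != 0.
  rewrite -[_ *m rho _]addr0 -(excess_rho (q^-1 * s)%g) -excess_comp.
  rewrite excess_indicator.
  have -> : ((fun h => (h * (q^-1 * s))%g) \o f0) @^-1: S = setT.
    by apply/setP=> x; rewrite !inE /= /f0 act0 mulKVg sS.
  apply: contraNneq SnT => /matrixP/(_ 0 0)/eqP; rewrite !mxE mulr1n subr_eq0 eqr_nat => /eqP eqS.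
  by rewrite eqEcard subsetT -eqS leqnn.
have [l [f [fl ld /positive_translate[h Sh]]]] := excess_chain (fun x => erefl) ww0 nz.
have [w [ww sw fw]] := reachP fl.
have [t [tD td Dh]] := diameter h.
exists (w ++ map (fun h => right_translation h) t); split.
- rewrite /is_word all_cat [all _ w]ww all_map; apply: sub_all tD => k.
  exact: translation_letter.
- by rewrite size_cat size_map; lia.
- apply: leq_trans Sh _; apply: subset_leq_card; apply/subsetP=> x.
  by rewrite !inE /word_act foldl_cat -!/(word_act _ _) word_act_translations -Dh fw.
Qed.

Lemma size_arith s s' m a b : (s < s')%N -> (s' <= m)%N ->
  (a <= (m - s') * m)%N -> (b <= m)%N -> (a + b <= (m - s) * m)%N.
Proof.
move=> ss s'm am bm; have -> : (m - s = (m - s') + (s' - s))%N by lia.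
rewrite mulnDl leq_add // (leq_trans bm) // leq_pmull //; lia.
Qed.

Lemma synchronizing_extension S : synchronizing Sigma -> (0 < #|S|)%N ->
  exists w, [/\ is_word Sigma w, (size w <= (n - #|S|) * n)%N
    & forall x, word_act x w \in S].
Proof.
move=> sync; have [m] := ubnP (n - #|S|); elim: m => // m IH in S * => lem S0.
have [->|SnT] := eqVneq S setT.
  by exists [::]; split=> // x; rewrite inE.
have [|w [ww sw Sw]] := preimage_extension sync _ SnT; first by rewrite -card_gt0.
have Sn := max_card (mem [set x | word_act x w \in S]).
have [||w' [ww' sw' w'S]] := IH [set x | word_act x w \in S].
- by rewrite (leq_trans _ (ltnSE lem)) // ltn_sub2l // (leq_trans Sw).
- exact: leq_ltn_trans Sw.
exists (w' ++ w); split.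
- by rewrite /is_word all_cat [all _ w']ww' [all _ w]ww.
- rewrite size_cat; exact: size_arith Sw Sn sw' sw.
- by move=> x; have := w'S x; rewrite inE /word_act foldl_cat.
Qed.

(** Some letter has a fibre with at least two elements; extending that fibre at most
    [n - 2] times, by at most [n] letters each time, reaches the whole group, and
    [1 + (n - 2) * n = (n - 1) ^ 2]. *)
Lemma short_synchronizing_word : (1 < n)%N -> synchronizing Sigma ->
  exists w, synchronizing_word Sigma w /\ (size w <= (n - 1) ^ 2)%N.
Proof.
move=> n1 sync; have [w0 [ww0 /eqP/cards1P[q0 im0]]] := sync.
have [a aS [q q2]] : exists2 a : {ffun gT -> gT}, a \in Sigma
    & exists q, (1 < #|[set x | a x == q]|)%N.
  have [inj|] := boolP [forall a in Sigma, injectiveb (a : {ffun gT -> gT})].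
    have winj w : is_word Sigma w -> injective (fun x => word_act x w).
      elim: w => [|a w IH]; first by move=> _ x y.
      rewrite /is_word /= => /andP[aS ww] x y /(IH ww).
      exact: (injectiveP _ (forall_inP inj a aS)).
    have := card_imset setT (winj _ ww0).
    have -> : [set word_act x w0 | x in setT] = [set q0].
      by rewrite -im0; apply/setP=> y; apply/imsetP/imsetP=> -[x _ ->]; exists x.
    by rewrite cards1 cardsT => n1'; rewrite -n1' in n1.
  rewrite negb_forall_in => /exists_inP[a aS /injectivePn[x [y xy axy]]].
  exists a => //; exists (a x); rewrite (cardsD1 x) (cardsD1 y) !inE eqxx axy eqxx.
  by rewrite eq_sym xy.
have [|w [ww sw wS]] := @synchronizing_extension [set x | a x == q] sync.
  exact: ltnW.
exists (rcons w a); split; first split.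
- by rewrite /is_word all_rcons aS.
- have act x : word_act x (rcons w a) = q.
    by have := wS x; rewrite inE /word_act foldl_rcons => /eqP.
  apply/eqP/cards1P; exists q; apply/setP=> y; rewrite inE.
  apply/imsetP/eqP=> [[x _ ->]|->]; first exact: act.
  by exists 1%g; rewrite ?act.
- rewrite size_rcons; apply: leq_ltn_trans sw _.
  have := max_card (mem [set x | a x == q]); have := q2.
  rewrite -[#|mem _|]/(#|[set x | a x == q]|).
  move: #|[set x | a x == q]| #|_| n1 => s m m1 s2 sm; nia.
Qed.

End Criterion.

(** The subspace [R] plays the role of the sum of the isotypic components of some
    irreducible rational representations of large dimension. *)
Theorem cerny_criterion (gT : finGroupType) (Delta : {set gT}) (d : nat)
    (R : 'M[rat]_#|gT|) :
    (1 < #|gT|)%N ->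
    (forall g, exists s : seq gT, [/\ all (fun h => h \in Delta) s, (size s <= d)%N
       & g = (\prod_(h <- s) h)%g]) ->
    left_stable R -> (R <= augmentation gT)%MS -> (2 * d <= \rank R)%N ->
    (forall M, submodule M ->
       \rank (M :&: R)%MS = 0%N \/ (2 * d.+1 + \rank (M :&: R) <= 2 * \rank M)%N) ->
  cerny_cayley_graph Delta.
Proof.
move=> n1 diam sR aR lR gR Sigma sub sync.
exact: (short_synchronizing_word diam sub sR aR lR gR).
Qed.

(** * Rational spaces with primitive roots of unity as eigenvalues *)

Section MatrixPolynomials.
Implicit Types (n : nat) (p q : {poly rat}).

(** The value of a polynomial at a square matrix of any size; in positive size it
    is [horner_mx]. *)
Definition mxpoly_eval n (A : 'M[rat]_n) q : 'M[rat]_n :=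
  \sum_(i < size q) q`_i *: (A ^+ i).

Lemma mxpoly_evalE n (A : 'M[rat]_n.+1) q : mxpoly_eval A q = horner_mx A q.
Proof.
rewrite /mxpoly_eval -[in RHS](coefK q) poly_def rmorph_sum /=.
by apply: eq_bigr => i _; rewrite linearZ /= rmorphXn /= horner_mx_X.
Qed.

Lemma mxpoly_evalM n (A : 'M[rat]_n) p q :
  mxpoly_eval A (p * q) = mxpoly_eval A p *m mxpoly_eval A q.
Proof.
case: n A => [|n] A; first by apply/matrixP=> -[].
by rewrite !mxpoly_evalE rmorphM.
Qed.

Lemma mxpoly_eval_comp n (A : 'M[rat]_n) p k :
  mxpoly_eval A (p \Po 'X^k) = mxpoly_eval (A ^+ k) p.
Proof.
case: n A => [|n] A; first by apply/matrixP=> -[].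
rewrite !mxpoly_evalE comp_polyE rmorph_sum /= -mxpoly_evalE.
by apply: eq_bigr => i _; rewrite linearZ /= !rmorphXn /= horner_mx_X.
Qed.

Lemma mxpoly_eval_comm n (A B : 'M[rat]_n) q :
  A *m B = B *m A -> mxpoly_eval A q *m B = B *m mxpoly_eval A q.
Proof.
case: n A B => [|n] A B AB; first by apply/matrixP=> -[].
by rewrite !mxpoly_evalE; apply: comm_horner_mx.
Qed.

Lemma mxpoly_eval_conj n m (A : 'M[rat]_n) (C : 'M[rat]_m) (B : 'M[rat]_(m, n)) q :
  B *m A = C *m B -> B *m mxpoly_eval A q = mxpoly_eval C q *m B.
Proof.
move=> BA; rewrite mulmx_sumr mulmx_suml; apply: eq_bigr => i _.
rewrite -scalemxAr -scalemxAl; congr (_ *: _).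
elim: (i : nat) => [|k IH]; first by rewrite !expr0 mulmx1 mul1mx.
by rewrite !exprSr -[_ * A]/(_ *m A) -[_ * C]/(_ *m C) mulmxA IH -!mulmxA BA.
Qed.

Lemma mxpoly_eval_geometric n (A : 'M[rat]_n) m :
  mxpoly_eval A (\sum_(i < m) 'X^i) = \sum_(i < m) A ^+ i.
Proof.
case: n A => [|n] A; first by apply/matrixP=> -[].
rewrite mxpoly_evalE rmorph_sum /=; apply: eq_bigr => i _.
by rewrite rmorphXn /= horner_mx_X.
Qed.

Lemma mxpoly_eval_XnB1 n (A : 'M[rat]_n) m : mxpoly_eval A ('X^m - 1) = A ^+ m - 1%:M.
Proof.
case: n A => [|n] A; first by apply/matrixP=> -[].
by rewrite mxpoly_evalE rmorphB rmorphXn rmorph1 /= horner_mx_X.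
Qed.

End MatrixPolynomials.

Section CyclotomicRational.
Local Notation pQtoC := (map_poly (ratr : rat -> algC)).

(** The cyclotomic polynomial is the common minimal polynomial of the primitive
    roots of unity. *)
Lemma cyclotomic_rat m : (0 < m)%N ->
  exists Phi : {poly rat}, [/\ size Phi = (totient m).+1,
    forall z, root (pQtoC Phi) z = m.-primitive_root z
  & forall z q, m.-primitive_root z -> root (pQtoC q) z = (Phi %| q)].
Proof.
move=> m0; have [z0 prim_z0] := C_prim_root_exists m0.
have [Phi [DPhi _] dvPhi] := minCpolyP z0.
rewrite (minCpoly_cyclotomic prim_z0) in DPhi.
exists Phi; split=> [|z|z q prim_z].
- by rewrite -(size_map_poly (ratr : {rmorphism rat -> algC})) -DPhi size_cyclotomic.
- by rewrite -DPhi root_cyclotomic.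
have [Psi [DPsi _] ->] := minCpolyP z.
suff -> : Psi = Phi by [].
apply: (map_poly_inj (ratr : {rmorphism rat -> algC})).
by rewrite -DPsi -DPhi (minCpoly_cyclotomic prim_z) -!Cintr_Cyclotomic.
Qed.

(** The minimal polynomial of [C] divides [Phi], hence has a primitive root of unity
    among its complex roots, hence is divisible by [Phi]. *)
Lemma annihilated_dim m (Phi : {poly rat}) r (C : 'M[rat]_r) : 
    size Phi = (totient m).+1 ->
    (forall z, root (pQtoC Phi) z = m.-primitive_root z) ->
    (forall z q, m.-primitive_root z -> root (pQtoC q) z = (Phi %| q)) ->
  (0 < r)%N -> mxpoly_eval C Phi = 0 -> (totient m <= r)%N.
Proof.
case: r C => // r C sPhi rPhi dPhi _; rewrite mxpoly_evalE => /mxminpoly_min dv.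
have s1 : (1 < size (pQtoC (mxminpoly C)))%N.
  by rewrite size_map_poly size_mxminpoly ltnS mxminpoly_nonconstant.
have [z rz] : exists z, root (pQtoC (mxminpoly C)) z.
  by apply/closed_rootP; rewrite neq_ltn s1 orbT.
have prim_z : m.-primitive_root z.
  by rewrite -rPhi; case/dvdpP: dv => q ->; rewrite rmorphM rootM rz orbT.
have Phi_dv : Phi %| char_poly C.
  by apply: dvdp_trans (mxminpoly_dvd_char C); rewrite -(dPhi z).
have := dvdp_leq _ Phi_dv; rewrite size_char_poly sPhi ltnS; apply.
by rewrite -size_poly_gt0 size_char_poly.
Qed.

(** The eigenvalues of [A] on [N] are primitive [m]-th roots of unity, and these are
    all conjugate over the rationals: if one occurs, all of them do. *)
Lemma primitive_space_dim m (Phi : {poly rat}) n (A N : 'M[rat]_n) :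
    size Phi = (totient m).+1 ->
    (forall z, root (pQtoC Phi) z = m.-primitive_root z) ->
    (forall z q, m.-primitive_root z -> root (pQtoC q) z = (Phi %| q)) ->
    stablemx N A -> N *m mxpoly_eval A Phi = 0 -> 
  \rank N = 0%N \/ (totient m <= \rank N)%N.
Proof.
move=> sPhi rPhi dPhi sN N0.
case: (posnP (\rank N)) => [->|r0]; [by left | right].
have /submxP[C BA] : (row_base N *m A <= row_base N)%MS.
  by rewrite stablemx_row_base.
apply: (@annihilated_dim m Phi _ C) => //.
apply: (row_free_inj (row_base_free N)); rewrite mul0mx.
rewrite -(mxpoly_eval_conj _ BA).
by apply/eqP; rewrite -submx0 -N0 submxMr ?eq_row_base.
Qed.

End CyclotomicRational.

Section TotientBound.

Lemma totient_part q n : prime q -> (0 < n)%N -> (totient (q ^ logn q n) <= totient n)%N.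
Proof.
move=> pr_q n0; have [m co_m {2}->] := pfactor_coprime pr_q n0.
rewrite mulnC totient_coprime ?coprimeXl //.
rewrite leq_pmulr // totient_gt0 lt0n; apply: contraTneq co_m => ->.
by rewrite /coprime gcdn0; have := prime_gt1 pr_q; case: q {pr_q} => [|[]].
Qed.

(** Every prime power that does not divide 120 has totient at least 6, so only the
    divisors of 120 are left to inspect. *)
Lemma totient_ge6 n : (12 < n)%N -> (6 <= totient n)%N.
Proof.
move=> n12; have n0 : (0 < n)%N by apply: leq_trans n12.
rewrite leqNgt; apply/negP => t6.
have : (n %| 120)%N.
  apply/dvdn_partP => // q; rewrite mem_primes => /and3P[pr_q _ q_n].
  have k0 : (0 < logn q n)%N by rewrite logn_gt0 mem_primes pr_q n0.
  have := leq_ltn_trans (totient_part pr_q n0) t6.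
  rewrite p_part totient_pfactor // => small.
  have q6 : (q < 7)%N.
    rewrite ltnNge; apply/negP => q7; move: small; rewrite ltnNge.
    case/negP; rewrite (leq_trans (_ : _ <= q.-1)%N) //; first by lia.
    by rewrite leq_pmulr // expn_gt0; lia.
  have pw a b : (a <= b)%N -> (q ^ a <= q ^ b)%N.
    by move=> ab; rewrite leq_pexp2l // prime_gt0.
  move: small pr_q pw k0; move: (logn q n) => k.
  move: q q6 {q_n} => [|[|[|[|[|[|[|//]]]]]]] _ //= small _ pw.
  - case: k small => [|[|[|[|k]]]] //= small _.
    by have := pw 3 k.+3 isT; lia.
  - case: k small => [|[|k]] //= small _.
    by have := pw 1 k.+1 isT; lia.
  - case: k small => [|[|k]] //= small _.
    by have := pw 1 k.+1 isT; lia.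
rewrite dvdn_divisors // => n120; move: n12 t6.
have /allP : all (fun m => (12 < m)%N ==> (6 <= totient m)%N) (divisors 120) by [].
by move/(_ n n120)/implyP => h /h; rewrite leqNgt => /negPf->.
Qed.

End TotientBound.

(** * The primitive principal series of a group with a Bruhat decomposition *)

Lemma rhoX (gT : finGroupType) (g : gT) k : rho (g ^+ k)%g = (rho g) ^+ k.
Proof.
elim: k => [|k IH]; first by rewrite expg0 rho1 expr0.
by rewrite expgS rhoM IH exprS.
Qed.

(** The hypotheses are the relations of [SL(2, F)] between the lower unipotent,
    the diagonal and a monomial matrix. The function [corner] is the entry at
    (0, 1): it vanishes on the Borel subgroup of lower triangular matrices, and on
    its complement it determines the double coset modulo lower unipotent matrices. *)
Section PrincipalSeries.
Variables (gT : finGroupType) (F : finFieldType).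
Local Notation n := #|gT|.
Local Notation q := #|F|.
Local Notation m := #|F|.-1.
Variables (lower torus : F -> gT) (w : gT) (corner : gT -> F).
Implicit Types (a c : F) (g : gT) (M : 'M[rat]_n).
Hypothesis lowerD : forall c c', lower (c + c') = (lower c * lower c')%g.
Hypothesis torusM : forall a a', a != 0 -> a' != 0 -> torus (a * a') = (torus a * torus a')%g.
Hypothesis torus_lower : forall a c, a != 0 ->
  (torus a * lower c = lower (c / a ^+ 2)%R * torus a)%g.
Hypothesis weyl_torus : forall a, a != 0 -> (w * torus a = torus a^-1%R * w)%g.
Hypothesis borelP : forall g, corner g = 0 ->
  exists a c, a != 0 /\ g = (torus a * lower c)%g.
Hypothesis bigP : forall g, corner g != 0 ->
  exists c c', g = (lower c * torus (corner g) * w * lower c')%g.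
Hypothesis corner_conj : forall g c,
  corner (g^-1 * lower c * g)%g = - (c * corner g ^+ 2).
Hypothesis card_borel : (q * #|[set g | corner g == 0%R]| <= #|[set g | corner g != 0%R]|)%N.

Variables (a0 : F) (Phi : {poly rat}).
Hypothesis prim_a0 : m.-primitive_root a0.
Hypothesis Phi_geom : Phi %| \sum_(i < m) 'X^i.
Hypothesis Phi_inv : Phi %| Phi \Po 'X^(m.-1).

Let m_gt0 : (0 < m)%N := prim_order_gt0 prim_a0.

Let a0_neq0 : a0 != 0.
Proof.
apply: contraTneq isT => a00; have := prim_expr_order prim_a0.
by rewrite a00 expr0n eqn0Ngt m_gt0 => /esym/eqP; rewrite oner_eq0.
Qed.

Let q_neq0 : q%:R != 0 :> rat.
Proof. by rewrite pnatr_eq0 -lt0n; apply/card_gt0P; exists 0. Qed.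

Let torus1 : torus 1 = 1%g.
Proof.
apply: (mulgI (torus 1)); rewrite mulg1 -torusM ?oner_neq0 //.
by rewrite mulr1.
Qed.

Let lower0 : lower 0 = 1%g.
Proof. by apply: (mulgI (lower 0)); rewrite mulg1 -lowerD addr0. Qed.

Let torusX k : torus (a0 ^+ k) = (torus a0 ^+ k)%g.
Proof.
elim: k => [|k IH]; first by rewrite torus1.
by rewrite exprS expgS torusM ?expf_neq0 // IH.
Qed.

Definition lower_sum : 'M[rat]_n := \sum_c rho (lower c).
Definition primitive_part : 'M[rat]_n := mxpoly_eval (rho (torus a0)) Phi.
(** The rows fixed by the lower unipotent subgroup on which the torus acts through
    its faithful characters. They generate the sum of the isotypic components of
    the representations induced from these characters of the Borel subgroup. *)
Definition principal : 'M[rat]_n :=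
  (kermx (lower_sum - (q%:R)%:M) :&: kermx primitive_part)%MS.

Local Notation eta := lower_sum.

Lemma lower_eta c : rho (lower c) *m eta = eta.
Proof.
rewrite mulmx_sumr [RHS](reindex_inj (addrI c)).
by apply: eq_bigr => e _; rewrite lowerD rhoM.
Qed.

Lemma eta_lower c : eta *m rho (lower c) = eta.
Proof.
rewrite mulmx_suml [RHS](reindex_inj (addIr c)).
by apply: eq_bigr => e _; rewrite lowerD rhoM.
Qed.

Lemma eta_sq : eta *m eta = q%:R *: eta.
Proof.
rewrite {1}/lower_sum mulmx_suml; under eq_bigr do rewrite lower_eta.
by rewrite sumr_const scaler_nat.
Qed.

Lemma torus_eta a : a != 0 -> rho (torus a) *m eta = eta *m rho (torus a).
Proof.
move=> a_neq0; rewrite mulmx_sumr mulmx_suml.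
have inj : injective (fun c => c / a ^+ 2).
  by apply: mulIf; rewrite invr_neq0 // expf_neq0.
rewrite [RHS](reindex_inj inj) /=.
by apply: eq_bigr => c _; rewrite -!rhoM torus_lower.
Qed.

Lemma principalP k (v : 'M[rat]_(k, n)) :
  reflect (v *m eta = q%:R *: v /\ v *m primitive_part = 0) (v <= principal)%MS.
Proof.
rewrite sub_capmx; apply: (iffP andP) => -[h1 h2]; split.
- by move/sub_kermxP/eqP: h1; rewrite mulmxBr mul_mx_scalar subr_eq0 => /eqP.
- exact/sub_kermxP.
- by apply/sub_kermxP/eqP; rewrite mulmxBr mul_mx_scalar subr_eq0 h1.
- exact/sub_kermxP.
Qed.

Lemma sum_torusE :
  \sum_(a : F | a != 0) rho (torus a) = mxpoly_eval (rho (torus a0)) (\sum_(i < m) 'X^i).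
Proof.
rewrite mxpoly_eval_geometric (reindex (fun i : 'I_m => a0 ^+ i)) /=.
  by apply: eq_big => i; rewrite ?expf_neq0 // torusX rhoX.
have m1 (a : F) : a != 0 -> a ^+ m = 1.
  move=> a_neq0; apply: (mulfI a_neq0).
  rewrite -exprS prednK ?expf_card ?mulr1 //.
  by apply/card_gt0P; exists 0.
exists (fun a => odflt (Ordinal m_gt0) [pick i : 'I_m | a0 ^+ i == a]) => [i _|a a_neq0].
  case: pickP => [j|/(_ i)]; last by rewrite eqxx.
  rewrite (eq_prim_root_expr prim_a0) !modn_small ?ltn_ord // => /eqP ji.
  exact: val_inj.
case: pickP => [j /eqP //|none].
have [i ai] := prim_rootP prim_a0 (m1 a a_neq0).
by have := none i; rewrite ai eqxx.
Qed.

Lemma left_stable_principal : left_stable principal.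
Proof.
move=> A cA; apply/principalP; have /principalP[e0 p0] := submx_refl principal.
have eA : eta *m A = A *m eta.
  by rewrite mulmx_sumr mulmx_suml; apply: eq_bigr => c _; rewrite cA.
have pA : primitive_part *m A = A *m primitive_part.
  exact: mxpoly_eval_comm (esym (cA _)).
split; first by rewrite -mulmxA -eA mulmxA e0 scalemxAl.
by rewrite -mulmxA -pA mulmxA p0 mul0mx.
Qed.

Section Members.
Variables (k : nat) (v : 'M[rat]_(k, n)).
Hypothesis vR : (v <= principal)%MS.

Let v_eta : v *m eta = q%:R *: v. Proof. by have /principalP[] := vR. Qed.
Let v_prim : v *m primitive_part = 0. Proof. by have /principalP[] := vR. Qed.

Lemma principal_lower c : v *m rho (lower c) = v.
Proof.
by apply: (scalerI q_neq0); rewrite scalemxAl -v_eta -mulmxA eta_lower.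
Qed.

Lemma principal_torus a : a != 0 -> (v *m rho (torus a) <= principal)%MS.
Proof.
move=> a_neq0; apply/principalP; split.
  by rewrite -mulmxA torus_eta // mulmxA v_eta scalemxAl.
have Pa : primitive_part *m rho (torus a) = rho (torus a) *m primitive_part.
  by apply: mxpoly_eval_comm; rewrite -!rhoM -!torusM // mulrC.
by rewrite -mulmxA -Pa mulmxA v_prim mul0mx.
Qed.

(** Every character of the torus occurring in [principal] is non-trivial. *)
Lemma principal_sum_torus : v *m (\sum_(a : F | a != 0) rho (torus a)) = 0.
Proof.
rewrite sum_torusE; case/dvdpP: Phi_geom => h ->.
by rewrite mulrC mxpoly_evalM mulmxA v_prim mul0mx.
Qed.

Lemma principal_aug : (v <= augmentation gT)%MS.
Proof.
apply/sub_kermxP; have := congr1 (mulmx^~ (const_mx 1 : 'cV_n)) principal_sum_torus.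
rewrite /= mul0mx -mulmxA mulmx_suml.
under eq_bigr do rewrite fmx_ones.
rewrite sumr_const -scaler_nat -scalemxAr => /eqP.
rewrite scaler_eq0 pnatr_eq0 => /orP[/eqP card0|/eqP //].
by have := card0_eq card0 a0; rewrite unfold_in /= a0_neq0.
Qed.

(** The unipotent factors of [g] are absorbed by [v] and by [eta]. *)
Lemma principal_big g : corner g != 0 ->
  v *m rho g *m eta = v *m rho (torus (corner g)) *m (rho w *m eta).
Proof.
move=> /bigP[c [c' {1}->]]; rewrite 3!rhoM !mulmxA principal_lower.
by rewrite -(mulmxA _ (rho (lower c'))) lower_eta.
Qed.

(** The element [w] inverts the torus, and the inverse of a faithful character is
    faithful. *)
Lemma principal_weyl : (v *m rho w *m eta <= principal)%MS.
Proof.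
apply/principalP; split; first by rewrite -mulmxA eta_sq scalemxAr.
have Pe : primitive_part *m eta = eta *m primitive_part.
  by apply: mxpoly_eval_comm; apply: torus_eta a0_neq0.
rewrite -mulmxA -Pe mulmxA -(mulmxA v).
have WA : rho w *m rho (torus a0) = rho (torus a0)^-1%g *m rho w.
  rewrite -!rhoM weyl_torus //; congr (rho (_ * _)%g).
  by apply: (mulIg (torus a0)); rewrite mulVg -torusM ?invr_eq0 // mulVf.
rewrite (mxpoly_eval_conj _ WA).
have -> : rho (torus a0)^-1%g = (rho (torus a0)) ^+ m.-1.
  rewrite -rhoX; congr rho; apply: (mulIg (torus a0)).
  by rewrite mulVg -expgSr prednK // -torusX prim_expr_order.
rewrite -mxpoly_eval_comp; case/dvdpP: Phi_inv => h ->.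
by rewrite mulrC mxpoly_evalM !mulmxA v_prim !mul0mx.
Qed.

End Members.

Lemma principal_hecke k (v : 'M[rat]_(k, n)) g : (v <= principal)%MS ->
  (v *m rho g *m eta <= principal)%MS.
Proof.
move=> vR; have [g0|g0] := eqVneq (corner g) 0.
  have [a [c [a_neq0 ->]]] := borelP g0.
  rewrite rhoM mulmxA -(mulmxA _ (rho (lower c))) lower_eta.
  have /principalP[-> _] := principal_torus vR a_neq0.
  by rewrite scalemx_sub ?principal_torus.
rewrite principal_big // mulmxA.
exact: principal_weyl (principal_torus vR g0).
Qed.

(** A central element of the group algebra, up to a factor the sum of the
    averages over the conjugates of the lower unipotent subgroup. *)
Definition spread : 'M[rat]_n := \sum_g rho g^-1%g *m eta *m rho g.

Lemma spread_comm g : spread *m rho g = rho g *m spread.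
Proof.
rewrite mulmx_suml mulmx_sumr [LHS](reindex_inj (mulIg g^-1%g)) /=.
apply: eq_bigr => h _; rewrite invMg invgK !rhoM -!mulmxA -!rhoM.
by rewrite mulVg mulg1.
Qed.

(** Conjugation by an element of the Borel subgroup preserves the lower unipotent
    subgroup. Any other conjugate consists of the identity and of one element with
    each non-zero corner; the latter contribute a sum over the torus, which is zero
    by [principal_sum_torus]. *)
Lemma principal_conj k (v : 'M[rat]_(k, n)) g : (v <= principal)%MS ->
  v *m (rho g^-1%g *m eta *m rho g) *m eta =
  (if corner g == 0 then q%:R ^+ 2 else q%:R) *: v.
Proof.
move=> vR; have /principalP[v_eta _] := vR.
have -> : v *m (rho g^-1%g *m eta *m rho g) *m eta =
    \sum_c v *m rho (g^-1 * lower c * g)%g *m eta.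
  have -> : rho g^-1%g *m eta *m rho g = \sum_c rho (g^-1 * lower c * g)%g.
    by rewrite mulmx_sumr mulmx_suml; apply: eq_bigr => c _; rewrite !rhoM.
  rewrite -mulmxA mulmx_suml mulmx_sumr.
  by apply: eq_bigr => c _; rewrite !mulmxA.
case: eqP => [/borelP[a [e [a_neq0 ->]]]|/eqP g0].
  rewrite expr2 -scalerA -v_eta scalemxAl -v_eta.
  have -> : v *m eta *m eta = \sum_(c : F) v *m eta.
    by rewrite -mulmxA eta_sq sumr_const -scaler_nat -scalemxAr.
  apply: eq_bigr => c _; congr (_ *m _).
  have -> : ((torus a * lower e)^-1 * lower c * (torus a * lower e) =
      (lower e)^-1 * lower (c * a ^+ 2)%R * lower e)%g.
    rewrite invMg -!mulgA; congr (_ * _)%g; rewrite !mulgA; congr (_ * _)%g.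
    apply: (mulgI (torus a)); rewrite torus_lower // mulfK ?expf_neq0 //.
    by rewrite !mulgA mulgV mul1g.
  have -> : ((lower e)^-1 = lower (- e))%g.
    by apply: (mulIg (lower e)); rewrite mulVg -lowerD addNr.
  by rewrite -!lowerD principal_lower.
rewrite (bigD1 0) //= lower0 mulg1 mulVg rho1 mulmx1 v_eta -[RHS]addr0.
congr (_ + _).
have s0 : \sum_(a | a != 0) v *m rho (torus a) *m (rho w *m eta) = 0.
  by rewrite -mulmx_suml -mulmx_sumr principal_sum_torus ?mul0mx.
rewrite -[RHS]s0.
have inj : injective (fun c => - (c * corner g ^+ 2)).
  by move=> c c' /oppr_inj; apply: mulIf; rewrite expf_neq0.
rewrite [RHS](reindex_inj inj) /=; apply: eq_big => c.
  by rewrite oppr_eq0 mulf_eq0 expf_eq0 (negPf g0) orbF.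
by move=> c0; rewrite principal_big // corner_conj // oppr_eq0 mulf_neq0 ?expf_neq0.
Qed.

Lemma hecke_arith N0 N1 Q D r : (0 < N0)%N -> (0 < Q)%N -> (Q * N0 <= N1)%N ->
  ((N0 * Q + N1) * D = (N0 + N1) * Q * r)%N -> (Q.+1 * r <= 2 * D)%N.
Proof.
move=> N0_gt0 Q_gt0 le eq.
have le2 : ((N0 * Q + N1) * Q.+1 <= 2 * ((N0 + N1) * Q))%N by nia.
rewrite -(leq_pmul2l (_ : 0 < N0 * Q + N1)%N); last by lia.
rewrite [X in (_ <= X)%N]mulnCA eq mulnA mulnA leq_mul2r le2 orbT //.
Qed.

(** The submodule [M1] generated by [R := M :&: principal] has [R] as its own
    intersection with [principal], by [principal_hecke], and [spread] acts on it as
    a scalar, by [principal_conj]. The trace of [spread] on [M1] is thus that scalar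
    times the dimension of [M1]; it is also the order of the group times the trace
    of [eta], which is [q] times the projection onto [R]. *)
Theorem principal_dim M : submodule M ->
  (q.+1 * \rank (M :&: principal) <= 2 * \rank M)%N.
Proof.
move=> sM; set R := (M :&: principal)%MS.
pose N0 := #|[set g | corner g == 0%R]|; pose N1 := #|[set g | corner g != 0%R]|.
pose cst : rat := (N0 * q + N1)%:R.
have RM : (R <= M)%MS := capmxSl _ _.
have RP : (R <= principal)%MS := capmxSr _ _.
have /principalP[R_eta _] := RP.
have spread_R : R *m spread = cst *: R.
  have eta_spread : eta *m spread = spread *m eta.
    rewrite {1}/lower_sum mulmx_suml [RHS]mulmx_sumr.
    by apply: eq_bigr => c _; rewrite spread_comm.
  apply: (scalerI q_neq0); rewrite scalemxAl -R_eta -mulmxA eta_spread mulmxA.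
  rewrite -mulmxA mulmx_suml mulmx_sumr.
  under eq_bigr do rewrite mulmxA principal_conj //.
  rewrite -scaler_suml (bigID (fun g => corner g == 0)) /= scalerA; congr (_ *: _).
  rewrite (eq_bigr (fun=> q%:R ^+ 2)) => [|g ->] //.
  rewrite [X in _ + X](eq_bigr (fun=> q%:R)) => [|g /negPf->] //.
  rewrite !sumr_const -[X in X + _]mulr_natr -[X in _ + X]mulr_natr.
  rewrite /cst natrD natrM.
  have -> : #|[pred g | corner g == 0]| = N0 by rewrite -cardsE.
  have -> : #|[pred g | corner g != 0]| = N1 by rewrite -cardsE.
  move: (N0%:R : rat) (N1%:R : rat) (q%:R : rat) => x y z.
  by ring.
pose M1 := (\sum_g <<R *m rho g>>)%MS : 'M[rat]_n.
have sM1 : submodule M1.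
  move=> h; have [_ ->] := sumsmxMr xpredT (fun g => <<R *m rho g>>%MS) (rho h).
  apply/sumsmx_subP => g _.
  have [_ ->] := eqmxMr (rho h) (genmxE (R *m rho g)).
  by rewrite -mulmxA -rhoM; apply: (sumsmx_sup (g * h)%g); rewrite ?genmxE.
have M1M : (M1 <= M)%MS.
  apply/sumsmx_subP => g _; rewrite genmxE.
  exact: submx_trans (submxMr _ RM) (sM g).
have RM1 : (R <= M1)%MS by apply: (sumsmx_sup 1%g); rewrite ?genmxE ?rho1 ?mulmx1.
have spread_M1 k (v : 'M[rat]_(k, n)) : (v <= M1)%MS -> v *m spread = cst *: v.
  move=> vM1; apply/eqP; rewrite -mul_mx_scalar -subr_eq0 -mulmxBr; apply/eqP.
  apply/sub_kermxP; apply: submx_trans vM1 _; apply/sumsmx_subP => g _.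
  rewrite genmxE; apply/sub_kermxP; rewrite mulmxBr mul_mx_scalar -mulmxA.
  by rewrite -spread_comm mulmxA spread_R -scalemxAl subrr.
have eta_M1 : (M1 *m eta <= R)%MS.
  have [_ ->] := sumsmxMr xpredT (fun g => <<R *m rho g>>%MS) eta.
  apply/sumsmx_subP => g _; have [_ ->] := eqmxMr eta (genmxE (R *m rho g)).
  rewrite sub_capmx principal_hecke // andbT.
  rewrite -mulmxA mulmx_sumr mulmx_sumr; apply: summx_sub => c _.
  by rewrite mulmxA -mulmxA -rhoM (submx_trans (submxMr _ RM) (sM _)).
pose Pi := oproj M1.
have Pi_sub : (Pi <= M1)%MS by rewrite -[Pi]mul1mx oproj_sub.
have Pi_idem : Pi *m Pi = Pi by rewrite oproj_id.
have Pi_rho g : Pi *m rho g = rho g *m Pi by rewrite oproj_rho.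
have Pi_eta : Pi *m eta = eta *m Pi.
  by rewrite mulmx_sumr mulmx_suml; apply: eq_bigr => c _; rewrite Pi_rho.
have rank_Pi : \rank Pi = \rank M1.
  apply/eqP; rewrite eqn_leq !mxrankS // -{1}(oproj_id (submx_refl M1)).
  exact: submxMl.
have Pi_R : R *m Pi = R by exact: oproj_id.
clearbody Pi.
pose E := (q%:R)^-1 *: (Pi *m eta).
have E_idem : E *m E = E.
  rewrite /E -scalemxAl -scalemxAr scalerA mulmxA -(mulmxA Pi) -Pi_eta mulmxA Pi_idem.
  by rewrite -mulmxA eta_sq -scalemxAr scalerA -mulrA mulVf // mulr1.
have rank_E : \rank E = \rank R.
  apply/eqP; rewrite eqn_leq !mxrankS //.
    have -> : R = R *m E.
      rewrite /E -scalemxAr mulmxA Pi_R R_eta scalerA mulVf // scale1r //.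
    exact: submxMl.
  exact: scalemx_sub (submx_trans (submxMr _ Pi_sub) eta_M1).
have tr_eta : \tr (Pi *m eta) = q%:R * (\rank R)%:R.
  by rewrite -rank_E -mxtrace_idem // mxtraceZ mulrA mulfV // mul1r.
have tr1 : \tr (Pi *m spread) = cst * (\rank M1)%:R.
  by rewrite spread_M1 // mxtraceZ mxtrace_idem // rank_Pi.
have tr2 : \tr (Pi *m spread) = n%:R * (q%:R * (\rank R)%:R).
  rewrite /spread mulmx_sumr raddf_sum /=.
  rewrite (eq_bigr (fun=> \tr (Pi *m eta))) => [|g _].
    by rewrite sumr_const tr_eta -[LHS]mulr_natl.
  rewrite !mulmxA mxtrace_mulC -!mulmxA (mulmxA (rho g)) -Pi_rho -mulmxA.
  by rewrite (mulmxA (rho g)) -rhoM mulgV rho1 mul1mx.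
have N01 : n = (N0 + N1)%N.
  by rewrite -(cardsC [set g | corner g == 0%R]) /N0 /N1; congr (_ + _)%N; apply: eq_card => g; rewrite !inE.
apply: leq_trans (_ : 2 * \rank M1 <= _)%N; last by rewrite leq_mul2l mxrankS ?orbT.
apply: (@hecke_arith N0 N1) => //.
- apply/card_gt0P; exists 1%g; rewrite inE.
  by have := corner_conj 1%g 0; rewrite lower0 !mulg1 invg1 mul0r oppr0 => ->.
- by apply/card_gt0P; exists 0.
apply/eqP; rewrite -(eqr_nat rat) natrM -/cst -tr1 tr2 -N01.
by rewrite -mulnA !natrM.
Qed.

Variable upper : F -> gT.
Hypothesis corner_upper : forall b b', corner ((upper b)^-1 * upper b')%g = b' - b.
Hypothesis corner_mul : forall g h, corner g = 0 -> (corner (h * g)%g == 0) = (corner h == 0).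
Hypothesis lower_torus_inj : forall c a, a != 0 -> (lower c * torus a = 1)%g -> a = 1 /\ c = 0.
Hypothesis torus_corner : forall a, a != 0 -> corner (torus a) = 0.
Hypothesis lower_corner : forall c, corner (lower c) = 0.

Hypothesis size_Phi : size Phi = (totient m).+1.
Hypothesis root_Phi : forall z : algC, root (map_poly ratr Phi) z = m.-primitive_root z.
Hypothesis dvd_Phi : forall (z : algC) P, m.-primitive_root z ->
  root (map_poly ratr P) z = (Phi %| P).
Hypothesis Phi_unity : Phi %| 'X^m - 1.

Section Coset.
Variable b : F.

(** The projection of [Q^G] to the rows supported in the left coset of the Borel
    subgroup by [upper b]. *)
Definition coset_proj : 'M[rat]_n :=
  diag_mx (\row_j (corner ((upper b)^-1 * enum_val j)%g == 0)%:R).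

Lemma basis_row_coset h :
  basis_row h *m coset_proj = (corner ((upper b)^-1 * h)%g == 0)%:R *: basis_row h.
Proof.
apply/rowP=> j; rewrite mul_mx_diag !mxE eqxx /= mulrC.
have [->|_] := eqVneq j (enum_rank h); last by rewrite !mulr0.
by rewrite enum_rankK.
Qed.

Lemma row_coset_proj i : row i coset_proj =
  (corner ((upper b)^-1 * enum_val i)%g == 0)%:R *: basis_row (enum_val i).
Proof. by rewrite -basis_row_coset /basis_row -rowE enum_valK. Qed.

Lemma coset_proj_rho g : corner g = 0 -> coset_proj *m rho g = rho g *m coset_proj.
Proof.
move=> g0; apply/row_matrixP=> i; rewrite !row_mul row_fmx basis_row_coset.
by rewrite mulgA corner_mul // row_coset_proj -scalemxAl basis_row_rho.
Qed.

Definition coset_part := (principal :&: coset_proj)%MS.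

Lemma coset_projP k (v : 'M[rat]_(k, n)) : reflect (v *m coset_proj = v) (v <= coset_proj)%MS.
Proof.
apply: (iffP idP) => [/submxP[u ->]|<-]; last exact: submxMl.
rewrite -mulmxA; congr (_ *m _); apply/row_matrixP=> i; rewrite row_mul.
rewrite row_coset_proj -scalemxAl basis_row_coset scalerA.
by case: (_ == 0); rewrite ?mulr1 ?mulr0 // !scale0r.
Qed.

(** Starting from a basis row, average over the lower unipotent subgroup and apply
    the cofactor [kappa] of [Phi] in ['X^m - 1]. The constant coefficient of [kappa]
    is not zero, and it is the coefficient of the resulting row at [upper b]. *)
Lemma coset_part_neq0 : \rank coset_part != 0%N.
Proof.
have [kappa Dk] : exists kappa, kappa * Phi = 'X^m - 1.
  by case/dvdpP: Phi_unity => h ->; exists h.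
pose v := basis_row (upper b) *m eta *m mxpoly_eval (rho (torus a0)) kappa.
have Pe P : mxpoly_eval (rho (torus a0)) P *m eta = eta *m mxpoly_eval (rho (torus a0)) P.
  by apply: mxpoly_eval_comm; apply: torus_eta a0_neq0.
have vR : (v <= principal)%MS.
  apply/principalP; split.
    by rewrite /v -mulmxA Pe mulmxA -(mulmxA _ eta eta) eta_sq -scalemxAr -scalemxAl.
  rewrite /v -mulmxA -mxpoly_evalM Dk.
  suff -> : mxpoly_eval (rho (torus a0)) ('X^m - 1) = 0 by rewrite mulmx0.
  by rewrite mxpoly_eval_XnB1 -rhoX -torusX prim_expr_order // torus1 rho1 subrr.
have vS : v *m coset_proj = v.
  have Se : coset_proj *m eta = eta *m coset_proj.
    rewrite mulmx_sumr [RHS]mulmx_suml.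
    by apply: eq_bigr => c _; rewrite coset_proj_rho.
  rewrite /v -mulmxA mxpoly_eval_comm; last by rewrite coset_proj_rho ?torus_corner.
  rewrite mulmxA -(mulmxA _ eta) -Se mulmxA basis_row_coset corner_upper subrr eqxx.
  by rewrite scale1r.
have term i : (i < m)%N ->
    basis_row (upper b) *m eta *m (rho (torus a0)) ^+ i *m indicator [set upper b]
    = (i == 0)%N%:R%:M.
  move=> im; have -> : basis_row (upper b) *m eta *m (rho (torus a0)) ^+ i *m indicator [set upper b]
      = \sum_c (lower c * torus (a0 ^+ i)%R == 1)%g%:R%:M.
    rewrite -rhoX -torusX -!mulmxA mulmx_suml mulmx_sumr.
    apply: eq_bigr => c _; rewrite !mulmxA !basis_row_rho basis_row_indicator inE.
    by rewrite -mulgA -[X in _ == X]mulg1 (inj_eq (mulgI _)).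
  have [->|i0] := eqVneq i 0%N.
    rewrite expr0 torus1 (bigD1 0) //= lower0 mulg1 eqxx big1 ?addr0 // => c c0.
    case: eqP => [e|_]; last by rewrite raddf0.
    by have [_ c0'] := lower_torus_inj (oner_neq0 _) (etrans (congr1 _ torus1) e); rewrite c0' eqxx in c0.
  rewrite big1 ?raddf0 // => c _; case: eqP => [e|_]; last by rewrite raddf0.
  have [/eqP] := lower_torus_inj (expf_neq0 i a0_neq0) e.
  by rewrite -(prim_order_dvd prim_a0) => /dvdn_leq; rewrite lt0n i0 leqNgt im => /(_ isT).
have kPhi : kappa * Phi != 0 by rewrite Dk -size_poly_gt0 size_XnsubC.
have [k0 Phi0] : kappa != 0 /\ Phi != 0 by apply/andP; rewrite -negb_or -mulf_eq0.
have size_k : (size kappa <= m)%N.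
  have := congr1 (fun P : {poly rat} => size P) Dk; rewrite size_mul // size_XnsubC //.
  rewrite size_Phi addnS /= => Dm.
  by rewrite -ltnS -Dm -addn1 leq_add2l totient_gt0.
have v0 : v *m indicator [set upper b] = (kappa`_0)%:M.
  rewrite /v /mxpoly_eval mulmx_sumr mulmx_suml.
  rewrite (eq_bigr (fun i : 'I_(size kappa) => if i == 0%N :> nat then (kappa`_0)%:M else 0)).
    have s0 : (0 < size kappa)%N by rewrite size_poly_gt0.
    rewrite (bigD1 (Ordinal s0)) //= big1 ?addr0 // => i.
    by rewrite -val_eqE /= => /negPf->.
  move=> i _; rewrite -scalemxAr -scalemxAl term; last exact: leq_trans (ltn_ord i) size_k.
  have [->|] := eqVneq (val i) 0%N; first by rewrite scale_scalar_mx mulr1.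
  by rewrite raddf0 scaler0.
have {}v0 : v != 0.
  apply/eqP=> v00; move: v0; rewrite v00 mul0mx => /matrixP/(_ 0 0)/eqP.
  rewrite !mxE mulr1n => /eqP kap0; have := congr1 (fun P : {poly rat} => P`_0) Dk.
  rewrite coef0M -kap0 mul0r coefB coefXn coef1 /= => /eqP.
  by rewrite [0%N == _]eq_sym (negPf (lt0n_neq0 m_gt0)) sub0r eq_sym oppr_eq0 oner_eq0.
rewrite mxrank_eq0; apply: contraNneq v0 => C0.
rewrite -submx0 -C0 sub_capmx vR.
exact/coset_projP.
Qed.

Lemma coset_part_dim : (totient m <= \rank coset_part)%N.
Proof.
have [] // := primitive_space_dim (A := rho (torus a0)) (N := coset_part) size_Phi root_Phi dvd_Phi.
- rewrite sub_capmx principal_torus ?capmxSl //=; apply/coset_projP.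
  have /coset_projP E : (coset_part <= coset_proj)%MS := capmxSr _ _.
  by rewrite -mulmxA -coset_proj_rho ?torus_corner // mulmxA E.
- by have /principalP[] : (coset_part <= principal)%MS := capmxSl _ _.
by move=> r0; have := coset_part_neq0; rewrite r0.
Qed.

End Coset.

Lemma principal_gap M : submodule M -> 
  \rank (M :&: principal)%MS = 0%N \/ (totient m <= \rank (M :&: principal)%MS)%N.
Proof.
move=> sM; apply: (primitive_space_dim (A := rho (torus a0)) size_Phi root_Phi dvd_Phi) => //.
  rewrite sub_capmx principal_torus ?capmxSr // andbT.
  exact: submx_trans (submxMr _ (capmxSl _ _)) (sM _).
by have /principalP[] : (M :&: principal <= principal)%MS := capmxSr _ _.
Qed.

Lemma coset_proj_disjoint b b' : b != b' -> coset_proj b' *m coset_proj b = 0.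
Proof.
move=> bb'; apply/row_matrixP=> i; rewrite row_mul row0.
rewrite row_coset_proj -scalemxAl basis_row_coset scalerA.
case: eqP => [c'|_]; last by rewrite mul0r scale0r.
case: eqP => [c|_]; last by rewrite mulr0 scale0r.
have := corner_mul ((upper b)^-1 * upper b')%g c'.
rewrite -mulgA mulKVg c eqxx corner_upper subr_eq0 => /esym/eqP eq.
by rewrite eq eqxx in bb'.
Qed.

(** The parts supported in different cosets are linearly independent. *)
Theorem principal_large : (q * totient m <= \rank principal)%N.
Proof.
have dx : mxdirect (\sum_b coset_part b).
  apply/mxdirect_sumsP => b _; apply/eqP/rowV0P => u.
  rewrite sub_capmx => /andP[uC uS].
  have /coset_projP <- : (u <= coset_proj b)%MS := submx_trans uC (capmxSr _ _).
  apply/sub_kermxP; apply: submx_trans uS _; apply/sumsmx_subP => b' /andP[_ bb'].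
  apply/sub_kermxP; have /coset_projP <- : (coset_part b' <= coset_proj b')%MS := capmxSr _ _.
  by rewrite -mulmxA coset_proj_disjoint ?mulmx0 // eq_sym.
have le : (\sum_b coset_part b <= principal)%MS by apply/sumsmx_subP => b _; apply: capmxSl.
apply: leq_trans (mxrankS le); rewrite (mxdirectP dx) /= -sum_nat_const.
by apply: leq_sum => b _; apply: coset_part_dim.
Qed.

Lemma gain_arith Q d r D : (d < 3 * Q)%N -> (6 <= r)%N -> (Q.+1 * r <= 2 * D)%N ->
  (2 * d.+1 + r <= 2 * D)%N.
Proof. by move=> dQ r6; apply: leq_trans; nia. Qed.

(** Here [6] is what makes the gain [(q + 1) / 2 * r] of a submodule meeting
    [principal] in dimension [r] exceed a diameter below [3 * q], with a surplus of
    half of [r]. *)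
Theorem principal_cerny (Delta : {set gT}) d :
    (6 <= totient m)%N -> (d < 3 * q)%N ->
    (forall g, exists s : seq gT, [/\ all (fun h => h \in Delta) s, (size s <= d)%N
       & g = (\prod_(h <- s) h)%g]) ->
  cerny_cayley_graph Delta.
Proof.
move=> t6 dq diam; have large := principal_large.
have large6 : (6 * q <= \rank principal)%N.
  by apply: leq_trans large; rewrite mulnC leq_mul2l t6 orbT.
apply: (@cerny_criterion gT Delta d principal) => //.
- have q0 : (0 < q)%N by apply/card_gt0P; exists 0.
  apply: leq_trans (rank_leq_row principal); apply: leq_trans large6; lia.
- exact: left_stable_principal.
- exact: principal_aug.
- by apply: leq_trans large6; rewrite -[6%N]/(2 * 3)%N -mulnA leq_mul2l ltnW.
move=> M sM; case: (principal_gap sM) => [->|gap]; [by left | right].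
exact: gain_arith dq (leq_trans t6 gap) (principal_dim sM).
Qed.

End PrincipalSeries.

(** * Matrices of determinant one *)

Ltac nz_field := field; repeat (apply/andP; split); rewrite ?oner_neq0 //.

Section SL2.
Variable F : finFieldType.
Local Notation G := (SL 2 F).
Implicit Types (a b c d : F) (g h : G).

Definition sl2 a b c d : G := insubd (1%g : G) (mx22 a b c d).

Lemma sl2_val a b c d : a * d - b * c = 1 -> slval (sl2 a b c d) = mx22 a b c d.
Proof. by move=> abcd; rewrite -[LHS]/(val _) val_insubd det_mx22 abcd eqxx. Qed.

Lemma mx22E (A : 'M[F]_2) : A = mx22 (A 0 0) (A 0 1) (A 1 0) (A 1 1).
Proof.
apply/matrixP=> i j; rewrite mxE.
by case: i => [[|[|i]] //= ?]; case: j => [[|[|j]] //= ?];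
  congr (A _ _); apply: val_inj.
Qed.

Lemma mx22M a b c d a' b' c' d' : mx22 a b c d *m mx22 a' b' c' d' =
  mx22 (a * a' + b * c') (a * b' + b * d') (c * a' + d * c') (c * b' + d * d').
Proof.
rewrite [LHS]mx22E; congr mx22; rewrite !mxE !big_ord_recl big_ord0 !mxE addr0 //=.
Qed.

Lemma sl2_det g : slval g 0 0 * slval g 1 1 - slval g 0 1 * slval g 1 0 = 1.
Proof. by have /eqP := sl_det g; rewrite {1}[slval g]mx22E det_mx22. Qed.

Lemma sl2E g : g = sl2 (slval g 0 0) (slval g 0 1) (slval g 1 0) (slval g 1 1).
Proof.
by apply: val_inj; rewrite [RHS]sl2_val ?sl2_det // -mx22E.
Qed.

Lemma sl2M a b c d a' b' c' d' : a * d - b * c = 1 -> a' * d' - b' * c' = 1 ->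
  (sl2 a b c d * sl2 a' b' c' d')%g =
  sl2 (a * a' + b * c') (a * b' + b * d') (c * a' + d * c') (c * b' + d * d').
Proof.
move=> e e'; apply: val_inj; rewrite /= !sl2_val ?mx22M //.
by transitivity ((a * d - b * c) * (a' * d' - b' * c')); [ring | rewrite e e' mulr1].
Qed.

Lemma sl2_1 : (1 : G)%g = sl2 1 0 0 1.
Proof.
apply: val_inj; rewrite /= sl2_val ?mulr1 ?mulr0 ?subr0 //.
by rewrite [LHS]mx22E !mxE.
Qed.

Definition lower c : G := sl2 1 0 c 1.
Definition upper b : G := sl2 1 b 0 1.
Definition torus a : G := sl2 a 0 0 a^-1.
Definition weyl b : G := sl2 0 b (- b^-1) 0.

Lemma lowerD c c' : lower (c + c') = (lower c * lower c')%g.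
Proof. by rewrite sl2M; [congr sl2 | |]; ring. Qed.

Lemma lower0 : lower 0 = 1%g. Proof. by rewrite sl2_1. Qed.

Lemma upperD b b' : upper (b + b') = (upper b * upper b')%g.
Proof. by rewrite sl2M; [congr sl2 | |]; ring. Qed.

Lemma upper0 : upper 0 = 1%g. Proof. by rewrite sl2_1. Qed.

Lemma torusM a a' : a != 0 -> a' != 0 -> torus (a * a') = (torus a * torus a')%g.
Proof. move=> ? ?; rewrite sl2M; [congr sl2 | |]; nz_field. Qed.

Lemma lower_torus a c : a != 0 -> (torus a * lower c = lower (c / a ^+ 2)%R * torus a)%g.
Proof. move=> ?; rewrite !sl2M; [congr sl2 | | | |]; nz_field. Qed.

Lemma weylE b : b != 0 -> weyl b = (torus b * weyl 1%R)%g.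
Proof. move=> ?; rewrite sl2M; [congr sl2 | |]; nz_field. Qed.

Lemma weyl_torus a : a != 0 -> (weyl 1%R * torus a = torus a^-1%R * weyl 1%R)%g.
Proof. move=> ?; rewrite !sl2M; [congr sl2 | | | |]; nz_field. Qed.

Lemma sl2_borel g : slval g 0 1 = 0 ->
  slval g 0 0 != 0 /\ g = (torus (slval g 0 0) * lower (slval g 0 0 * slval g 1 0)%R)%g.
Proof.
move=> g01; have := sl2_det g; rewrite g01 mul0r subr0 => ad1.
have a0 : slval g 0 0 != 0.
  by apply: contra_eq_neq ad1 => ->; rewrite mul0r eq_sym oner_neq0.
have d1 : slval g 1 1 = (slval g 0 0)^-1 by apply: (mulfI a0); rewrite ad1 mulfV.
split=> //; rewrite [LHS]sl2E g01 d1 sl2M; [congr sl2 | |]; nz_field.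
Qed.

Lemma sl2_big g (b := slval g 0 1) : b != 0 ->
  g = (lower (slval g 1 1 / b)%R * weyl b * lower (slval g 0 0 / b)%R)%g.
Proof.
rewrite /b => b0; have dt := sl2_det g.
have c1 : slval g 1 0 = (slval g 0 0 * slval g 1 1 - 1) / slval g 0 1.
  by apply: (mulfI b0); rewrite -dt; field.
rewrite [LHS]sl2E c1 !sl2M; [congr sl2| | | |]; nz_field.
Qed.

Lemma sl2_upper_lower g (b := slval g 0 1) : b != 0 ->
  g = (lower ((slval g 1 1 - 1) / b)%R * upper b * lower ((slval g 0 0 - 1) / b)%R)%g.
Proof.
rewrite /b => b0; have dt := sl2_det g.
have c1 : slval g 1 0 = (slval g 0 0 * slval g 1 1 - 1) / slval g 0 1.
  by apply: (mulfI b0); rewrite -dt; field.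
rewrite [LHS]sl2E c1 !sl2M; [congr sl2| | | |]; nz_field.
Qed.

Lemma sl2V a b c d : a * d - b * c = 1 -> (sl2 a b c d)^-1%g = sl2 d (- b) (- c) a.
Proof.
move=> abcd; apply: (mulIg (sl2 a b c d)); rewrite mulVg sl2M //.
  by rewrite sl2_1 -abcd; congr sl2; ring.
by rewrite -abcd; ring.
Qed.

(** As [lower e - 1] has only the entry [e] at (1, 0), its conjugate is [e] times the
    second column of the inverse by the first row [(a, b)] of the matrix. *)
Lemma lower_conj a b c d e : a * d - b * c = 1 ->
  ((sl2 a b c d)^-1 * lower e * sl2 a b c d)%g =
  sl2 (1 - e * b * a) (- (e * b ^+ 2)) (e * a ^+ 2) (1 + e * a * b).
Proof.
move=> abcd; rewrite sl2V // !sl2M //; try by [ring | rewrite -[RHS]abcd; ring].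
by congr sl2; rewrite -?[in RHS]abcd; ring.
Qed.

(** The entry whose vanishing defines the Borel subgroup of lower triangular
    matrices. *)
Definition entry01 g := slval g 0 1.

Lemma entry01E a b c d : a * d - b * c = 1 -> entry01 (sl2 a b c d) = b.
Proof. by move=> e; rewrite /entry01 sl2_val // mxE. Qed.

(** A lower triangular matrix is given by [a != 0] at (0, 0) and its entry [c] at
    (1, 0); with a further [s] in [F], the matrix with diagonal [s], [c] and entry
    [a] at (0, 1) has determinant one for a unique entry at (1, 0). *)
Lemma card_borel_le : (#|F| * #|[set g | entry01 g == 0%R]| <= #|[set g | entry01 g != 0%R]|)%N.
Proof.
pose f (x : F * G) := sl2 x.1 (slval x.2 0 0)
  ((x.1 * slval x.2 1 0 - 1) / slval x.2 0 0) (slval x.2 1 0).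
have dt (x : F * G) : slval x.2 0 0 != 0 ->
  x.1 * slval x.2 1 0 - slval x.2 0 0 * ((x.1 * slval x.2 1 0 - 1) / slval x.2 0 0) = 1.
  by move=> ?; field.
rewrite -cardsT -cardsX -(card_in_imset (f := f)).
  apply/subset_leq_card/subsetP => y /imsetP[[s g]]; rewrite !inE /= => /eqP g01 ->.
  by have [a0 _] := sl2_borel g01; rewrite entry01E ?dt.
move=> [s g] [s' g']; rewrite !inE /= => /eqP g01 /eqP g01' E.
have [a0 gE] := sl2_borel g01; have [a0' gE'] := sl2_borel g01'.
have := congr1 (fun h : G => slval h) E; rewrite !sl2_val ?dt // => /matrixP E'.
have := (E' 0 0, E' 0 1, E' 1 1); rewrite !mxE /= => -[[-> Ea] Ec].
by rewrite gE gE' Ea Ec.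
Qed.

End SL2.

(** * Cayley graphs of SL(2, F) *)

Lemma finField_prim_root (F : finFieldType) :
  exists a : F, (#|F|.-1).-primitive_root a.
Proof.
have F1 := card_finNzRing_gt1 F.
have c1 : (0 < #|F|.-1)%N by rewrite -ltnS prednK // ltnW.
have unity : all (#|F|.-1).-unity_root (enum (predC1 (0 : F))).
  apply/allP=> a; rewrite mem_enum => a0; apply/unity_rootP.
  by apply: (mulfI a0); rewrite -exprS prednK ?expf_card ?mulr1 // ltnW.
have /hasP[a _ prim_a] := has_prim_root c1 unity (enum_uniq _) (eq_leq (esym (etrans (esym (cardE _)) (cardC1 _)))).
by exists a.
Qed.

Section SL2Structure.
Variable F : finFieldType.
Implicit Types (a b c : F) (g h : SL 2 F).

Lemma sl2_bigP g : entry01 g != 0 ->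
  exists c c', g = (lower c * torus (entry01 g) * weyl 1%R * lower c')%g.
Proof.
move=> g0; exists (slval g 1 1 / entry01 g), (slval g 0 0 / entry01 g).
by rewrite -(mulgA (lower _)) -weylE //; apply: sl2_big.
Qed.

Lemma borelP g : entry01 g = 0 -> exists a c, a != 0 /\ g = (torus a * lower c)%g.
Proof.
move=> /sl2_borel[a0 E].
by exists (slval g 0 0), (slval g 0 0 * slval g 1 0).
Qed.

Lemma entry01_conj g c :
  entry01 (g^-1 * lower c * g)%g = - (c * entry01 g ^+ 2).
Proof.
have dt := sl2_det g; rewrite {1 2}[g]sl2E lower_conj // entry01E //.
by rewrite /entry01; ring.
Qed.

Lemma entry01_upper b b' : entry01 ((upper b)^-1 * upper b')%g = b' - b.
Proof.
have -> : ((upper b)^-1 = upper (- b))%g.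
  by apply: (mulIg (upper b)); rewrite mulVg -upperD addNr upper0.
rewrite -upperD entry01E; last by ring.
by rewrite addrC.
Qed.

Lemma entry01M g h : entry01 (h * g)%g =
  slval h 0 0 * entry01 g + slval h 0 1 * slval g 1 1.
Proof.
have dg := sl2_det g; have dh := sl2_det h.
rewrite {1}[g]sl2E {1}[h]sl2E sl2M // entry01E //.
by rewrite -[1 in RHS]mulr1 -{1}dg -dh; ring.
Qed.

Lemma entry01_borel g h : entry01 g = 0 -> (entry01 (h * g)%g == 0) = (entry01 h == 0).
Proof.
move=> g0; rewrite entry01M g0 mulr0 add0r mulf_eq0.
suff /negPf-> : slval g 1 1 != 0 by rewrite orbF.
have := sl2_det g; rewrite -/(entry01 g) g0 mul0r subr0.
by apply: contra_eq_neq => ->; rewrite mulr0 eq_sym oner_eq0.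
Qed.

Lemma lower_torus_eq1 c a : a != 0 -> (lower c * torus a = 1)%g -> a = 1 /\ c = 0.
Proof.
move=> a0; rewrite sl2M ?sl2_1; [|by ring|by rewrite mul0r subr0 mulfV].
move=> /(congr1 (fun h : SL 2 F => slval h)) /matrixP E.
have := (E 0 0, E 1 0); rewrite !sl2_val; [|by ring|by field]; rewrite !mxE /=.
rewrite !(mul1r, mul0r, mulr0, addr0) => -[ea ec]; split=> //.
by move: ec; rewrite ea mulr1.
Qed.

Lemma entry01_torus a : a != 0 -> entry01 (torus a) = 0.
Proof. by move=> a0; rewrite entry01E // mul0r subr0 mulfV. Qed.

Lemma entry01_lower c : entry01 (lower c) = 0.
Proof. by rewrite entry01E //; ring. Qed.

End SL2Structure.

Lemma cyclotomic_rat_dvd m : (1 < m)%N ->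
  exists Phi : {poly rat}, [/\ [/\ size Phi = (totient m).+1,
    (forall z : algC, root (map_poly ratr Phi) z = m.-primitive_root z)
  & forall (z : algC) P, m.-primitive_root z -> root (map_poly ratr P) z = (Phi %| P)],
    Phi %| \sum_(i < m) 'X^i, Phi %| Phi \Po 'X^(m.-1) & Phi %| 'X^m - 1].
Proof.
move=> m1; have m0 := ltnW m1.
have [Phi [sPhi rPhi dPhi]] := cyclotomic_rat m0.
have [z pz] := C_prim_root_exists m0; exists Phi; split=> //.
- have z1 : z != 1.
    apply: contraTneq pz => ->; apply/negP => /prim_order_dvd/(_ 1%N).
    by rewrite expr1 eqxx dvdn1 => /eqP; lia.
  rewrite -(dPhi z) // rmorph_sum /=.
  apply/rootP/eqP; rewrite -(inj_eq (mulfI (_ : z - 1 != 0))) ?subr_eq0 //.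
  rewrite mulr0 horner_sum.
  under eq_bigr do rewrite map_polyXn hornerXn.
  by rewrite -subrX1 prim_expr_order // subrr.
- rewrite -(dPhi z) // map_comp_poly map_polyXn rootE horner_comp hornerXn -rootE.
  rewrite rPhi prim_root_exp_coprime //.
  by case: m m1 {m0 sPhi rPhi dPhi pz} => // m _; rewrite coprimenS.
- rewrite -(dPhi z) // rmorphB rmorph1 /= map_polyXn rootE !hornerE.
  by rewrite prim_expr_order // subrr.
Qed.

(** The bound on the order of [F] ensures at least six faithful characters of the
    torus. *)
Theorem sl2_cerny (F : finFieldType) (Delta : {set SL 2 F}) d :
    (13 < #|F|)%N -> (d < 3 * #|F|)%N ->
    (forall g : SL 2 F, exists s : seq (SL 2 F),
       [/\ all (fun h => h \in Delta) s, (size s <= d)%N & g = (\prod_(h <- s) h)%g]) ->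
  cerny_cayley_graph Delta.
Proof.
move=> q13 dq diam.
have m12 : (12 < #|F|.-1)%N by lia.
have t6 := totient_ge6 m12.
have [a0 prim_a0] := finField_prim_root F.
have [Phi [[sPhi rPhi dPhi] geom inv unity]] := cyclotomic_rat_dvd (ltn_trans (isT : 1 < 12)%N m12).
exact: (principal_cerny (@lowerD F) (@torusM F) (@lower_torus F) (@weyl_torus F)
    (@borelP F) (@sl2_bigP F) (@entry01_conj F) (@card_borel_le F) prim_a0 geom inv
    (@entry01_upper F) (@entry01_borel F) (@lower_torus_eq1 F) (@entry01_torus F)
    (@entry01_lower F) sPhi rPhi dPhi unity t6 dq diam).
Qed.

(** * Words in the two transvections *)

Section Transvections.
Variables (F : finFieldType) (p : nat).
Hypothesis natF : forall c : F, exists2 k, (k < p)%N & c = k%:R.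
Implicit Types (c b : F) (g : SL 2 F).
Local Notation x := (sl_x F).
Local Notation y := (sl_y F).

Lemma sl_xE : x = upper 1.
Proof. by apply: val_inj; rewrite [RHS]sl2_val //; ring. Qed.

Lemma sl_yE : y = lower 1.
Proof. by apply: val_inj; rewrite [RHS]sl2_val //; ring. Qed.

Lemma prod_nseq k g : (\prod_(h <- nseq k g) h = g ^+ k)%g.
Proof. by elim: k => [|k IH]; rewrite ?big_nil //= big_cons IH expgS. Qed.

Lemma upper_pow k : upper (k%:R : F) = (x ^+ k)%g.
Proof.
elim: k => [|k IH]; first by rewrite upper0.
by rewrite expgS -IH sl_xE -upperD -natr1 addrC.
Qed.

Lemma lower_pow k : lower (k%:R : F) = (y ^+ k)%g.
Proof.
elim: k => [|k IH]; first by rewrite lower0.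
by rewrite expgS -IH sl_yE -lowerD -natr1 addrC.
Qed.

(** Matrices with non-zero entry at (0, 1) are products of a lower, an upper and
    again a lower transvection, each a power of a generator. *)
Lemma short_word_big g : entry01 g != 0 -> exists s,
  [/\ all (fun h => h \in [set x; y]) s, (size s <= 3 * p.-1)%N & g = (\prod_(h <- s) h)%g].
Proof.
move=> g0.
have [i ip Di] := natF ((slval g 1 1 - 1) / slval g 0 1).
have [j jp Dj] := natF (slval g 0 1).
have [k kp Dk] := natF ((slval g 0 0 - 1) / slval g 0 1).
exists (nseq i y ++ nseq j x ++ nseq k y); split.
- by rewrite !all_cat !all_nseq !inE !eqxx !orbT.
- by rewrite !size_cat !size_nseq; lia.
rewrite !big_cat !prod_nseq /= mulgA -!lower_pow -upper_pow -Di -Dk -Dj.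
exact: sl2_upper_lower g0.
Qed.

(** If the entry of [g] at (0, 1) vanishes, that of [x^-1 * g] does not. *)
Lemma short_word g : exists s, [/\ all (fun h => h \in [set x; y]) s,
  (size s <= (3 * p.-1).+1)%N & g = (\prod_(h <- s) h)%g].
Proof.
have [g0|/short_word_big[s [sD ss ->]]] := eqVneq (entry01 g) 0; last first.
  by exists s; split=> //; apply: leqW.
have xV : (x^-1 = upper (- 1))%g.
  by apply: (mulIg x); rewrite mulVg sl_xE -upperD addNr upper0.
have [|s [sD ss Ds]] := @short_word_big (x^-1 * g)%g.
  rewrite xV entry01M g0 mulr0 add0r sl2_val; last by ring.
  rewrite mxE /= mulN1r oppr_eq0; have := sl2_det g.
  rewrite -/(entry01 g) g0 mul0r subr0.
  by apply: contra_eq_neq => ->; rewrite mulr0 eq_sym oner_eq0.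
exists (x :: s); split; rewrite /= ?sD ?inE ?eqxx //.
by rewrite big_cons -Ds mulKVg.
Qed.

End Transvections.

Theorem mainTheorem9 (p : nat) (p_prime : prime p) (p_ge17 : (17 <= p)%N) :
  generates [set sl_x 'F_p; sl_y 'F_p] /\
  cerny_cayley_graph [set sl_x 'F_p; sl_y 'F_p].
Proof.
have natF (c : 'F_p) : exists2 k, (k < p)%N & c = k%:R.
  exists (c : nat); last by rewrite natr_Zp.
  by have := ltn_ord c; rewrite [X in (_ < X)%N](Fp_cast p_prime).
have words := short_word natF.
split.
  apply/setP=> g; rewrite inE; have [s [/allP sD _ ->]] := words g.
  by rewrite big_seq group_prod // => h /sD hD; rewrite mem_gen.
apply: (sl2_cerny _ _ words); rewrite card_Fp //.
  exact: leq_trans p_ge17.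
by case: p p_prime p_ge17 {natF words} => // p' _ _; rewrite /= mulnS.
Qed.
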